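(* For each positive integer $n$ let $\mathcal{P}_n\subset\mathbb{R}^n$ be the convex hull of all parking functions of length $n$. Define a sequence $\{V_n\}_{n\ge 0}$ by $V_0=1$ and $V_n=\mathrm{Vol}(\mathcal{P}_n)$ (the $n$-dimensional volume) for all positive integers $n$. Then for all $n\ge 2$, $$V_n=\frac{1}{n}\sum_{k=0}^{n-1}\binom{n}{k}\frac{(n-k)^{n-k-1}(n+k-1)}{2}V_{k}.$$
   Context: A sequence $\alpha=(a_1,\dots,a_n)$ with $a_i\in\{1,\dots,n\}$ is a parking function of length $n$ if its weakly increasing rearrangement $b_1\le b_2\le\dots\le b_n$ satisfies $b_i\le i$ for all $i\in\{1,\dots,n\}$. Volume is $n$-dimensional Lebesgue measure on $\mathbb{R}^n$; in particular $V_1=0$ since $\mathcal{P}_1=\{1\}$ is a point. *)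

(* Defs.v *)
From HB Require Import structures.
From mathcomp Require Import all_boot all_order all_algebra.
From mathcomp Require Import all_classical all_reals all_analysis.
Import Order.TTheory GRing.Theory Num.Theory.

Set Implicit Arguments.
Unset Strict Implicit.
Unset Printing Implicit Defensive.

Local Open Scope classical_set_scope.
Local Open Scope ring_scope.

(* [sort] is indexed from 0, so b_i <= i reads [nth 0 (sort leq a) i <= i.+1] *)
Definition parking_function (n : nat) (a : n.-tuple nat) : bool :=
  all (fun x => 0 < x <= n)%N a &&
  [forall i : 'I_n, (nth 0 (sort leq a) i <= i.+1)%N].

Definition parking_points (R : realType) (n : nat) : set 'rV[R]_n :=
  [set v | exists2 a : n.-tuple nat,
     parking_function a & v = \row_(i < n) (tnth a i)%:R].

Definition convex_hull (R : realType) (M : lmodType R) (A : set M) : set M :=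
  smallest (@convex_set R M) A.

Definition parking_polytope (R : realType) (n : nat) : set 'rV[R]_n :=
  convex_hull (@parking_points R n).

(* n-dimensional Lebesgue measure, on tuples with the product sigma-algebra:
   the n-fold product of the Lebesgue measure on the real line. *)
Section tuple_cons_measure.
Context (d : measure_display) (T : measurableType d) (R : realType) (n : nat).
Variable mu : {sigma_finite_measure set T -> \bar R}.
Variable m : {sigma_finite_measure set (n.-tuple T) -> \bar R}.
Local Open Scope ereal_scope.

Definition tuple_cons (x : T * n.-tuple T) : n.+1.-tuple T :=
  [tuple of x.1 :: x.2].

Lemma measurable_tuple_cons : measurable_fun [set: T * n.-tuple T] tuple_cons.
Proof. exact: (measurable_cons measurable_fst measurable_snd). Qed.

Definition cons_measure : set (n.+1.-tuple T) -> \bar R :=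
  pushforward (mu \x m) tuple_cons.

Let cons_measure0 : cons_measure set0 = 0.
Proof. by rewrite /cons_measure /pushforward preimage_set0 measure0. Qed.

Let cons_measure_ge0 A : 0 <= cons_measure A.
Proof. exact: (measure_ge0 (mu \x m)). Qed.

Let cons_measure_sigma_additive : semi_sigma_additive cons_measure.
Proof.
have mcons A : measurable A -> measurable (tuple_cons @^-1` A).
  by move=> mA; rewrite -[X in measurable X]setTI; exact: measurable_tuple_cons.
move=> F mF tF mUF; rewrite /cons_measure /pushforward preimage_bigcup.
apply: measure_semi_sigma_additive.
- by move=> k; exact: mcons.
- apply/trivIsetP => /= i j _ _ ij; rewrite -preimage_setI.
  by move/trivIsetP : tF => /(_ _ _ _ _ ij) ->//; rewrite preimage_set0.
- by rewrite -preimage_bigcup; exact: mcons.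
Qed.

HB.instance Definition _ := isMeasure.Build _ _ _ cons_measure
  cons_measure0 cons_measure_ge0 cons_measure_sigma_additive.

Let uncons (t : n.+1.-tuple T) : T * n.-tuple T :=
  (tnth t ord0, [tuple of behead t]).

Let measurable_uncons : measurable_fun [set: n.+1.-tuple T] uncons.
Proof.
apply/measurable_fun_pairP; split.
- exact: (@measurable_tnth _ _ _ ord0).
- exact: measurable_behead.
Qed.

Let tuple_consK : cancel tuple_cons uncons.
Proof. by move=> [x t]; congr pair; apply/val_inj. Qed.

Let cons_measure_sigma_finite : sigma_finite setT cons_measure.
Proof.
have /sigma_finiteP[F [TF ndF Foo]] := sigma_finiteT mu.
have /sigma_finiteP[G [TG ndG Goo]] := sigma_finiteT m.
exists (fun k => uncons @^-1` (F k `*` G k)).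
  rewrite -preimage_bigcup; apply/esym; rewrite -subTset => t _ /=.
  have [i _ Fi] : (\bigcup_i F i) (uncons t).1 by rewrite -TF.
  have [j _ Gj] : (\bigcup_i G i) (uncons t).2 by rewrite -TG.
  exists (maxn i j) => //; split.
  - by move: Fi; exact/subsetPset/ndF/leq_maxl.
  - by move: Gj; exact/subsetPset/ndG/leq_maxr.
move=> k; have [mF Fk] := Foo k; have [mG Gk] := Goo k; split.
  rewrite -[X in measurable X]setTI; apply: measurable_uncons => //.
  exact: measurableX.
rewrite /cons_measure /pushforward -comp_preimage.
rewrite (_ : uncons \o tuple_cons = id); last first.
  by apply/funext => x /=; rewrite tuple_consK.
by rewrite preimage_id product_measure1E// lte_mul_pinfty// ge0_fin_numE.
Qed.

HB.instance Definition _ := Measure_isSigmaFinite.Build _ _ _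
  cons_measure cons_measure_sigma_finite.

End tuple_cons_measure.

Fixpoint lebesgue_tuple (R : realType) (n : nat) :
    {sigma_finite_measure set (n.-tuple (measurableTypeR R)) -> \bar R} :=
  if n is n'.+1 then cons_measure (@lebesgue_measure R) (lebesgue_tuple R n')
  else \d_[tuple].

Definition volume (R : realType) (n : nat) (A : set 'rV[R]_n) : \bar R :=
  lebesgue_tuple R n [set t | A (\row_(i < n) tnth t i)].

Lemma lebesgue_tuple_box (R : realType) (n : nat)
    (A : 'I_n -> set (measurableTypeR R)) : (forall i, measurable (A i)) ->
  lebesgue_tuple R n [set t | forall i, A i (tnth t i)] =
  (\prod_(i < n) lebesgue_measure (A i))%E.
Proof.
elim: n A => [|n IH] A mA.
  by rewrite big_ord0 /= diracE mem_set// => -[].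
rewrite big_ord_recl -IH// -product_measure1E//=; last first.
  rewrite (_ : [set t | _] = \bigcap_(i in [set: 'I_n])
      ((@tnth _ _ ^~ i) @^-1` A (lift ord0 i))).
    apply: fin_bigcap_measurable => // i _.
    by rewrite -[X in measurable X]setTI; exact: measurable_tnth.
  by apply/seteqP; split => t /= h i; [move=> _; exact: h|exact: (h i I)].
rewrite /cons_measure /pushforward; congr (_ _).
apply/seteqP; split => -[x t] /=.
  move=> h; split; first exact: (h ord0).
  by move=> i; have := h (lift ord0 i); rewrite tnthS.
move=> [Ax At] i; have [j ->|->//] := unliftP ord0 i.
by rewrite tnthS; exact: At.
Qed.

(* Extended-real valued, so that no convention on infinite volumes is needed. *)
Definition V (R : realType) (n : nat) : \bar R :=
  if n is 0 then 1%E else volume (@parking_polytope R n).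

(* Main.v *)
Require Import Defs.
From mathcomp Require Import all_boot all_order all_algebra.
From mathcomp Require Import all_classical all_reals all_analysis.
From mathcomp Require Import measurable_realfun.
From mathcomp Require Import ring lra zify.
Import Order.TTheory GRing.Theory Num.Theory.
Import numFieldNormedType.Exports.

Set Implicit Arguments.
Unset Strict Implicit.
Unset Printing Implicit Defensive.

Local Open Scope classical_set_scope.
Local Open Scope ring_scope.

(* Translated by (1, .., 1), the parking polytope is the polymatroid
     Q(e) = {x >= 0 | every sum of k coordinates of x is <= e_0 + .. + e_(k-1)}
   with e = (n-1, n-2, .., 0). For an arbitrary weakly decreasing e >= 0, the
   section of Q(e_0, .., e_n) by x_0 = t with e_(i+1) <= t <= e_i (lower bound
   0 if i = n) is again of this form, for the sequence
     (e_0, .., e_(i-1), e_i + e_(i+1) - t, e_(i+2), .., e_n).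
   By induction, Q(e) is the convex hull of the points obtained by permuting e
   and replacing some entries by 0, and by Fubini vol Q(e) = W_n(e), where
     W_(n+1)(e) = e_n W_n(e)
       + sum_(i < n) int_(e_(i+1))^(e_i) W_n(e_0, .., e_(i-1), s, e_(i+2), ..) ds.
   Let P_n(e) be defined by the same recursion without the term e_n W_n and with
   P_1 = 1 (it is the normalised volume of the permutohedron of e). Inductively,
     d W_n / d e_j = sum_(k > j) C(n,k) P_k(e) W_(n-k)(e_k, e_(k+1), ..),
       n W_n = sum_k (e_0 + .. + e_(k-1)) C(n,k) P_k(e) W_(n-k)(e_k, ..).
   Differentiating the second identity in e_(n-1) gives a quadratic recursion
   for P_n; with the translation invariance of P_n and Abel's identity it yields
   k P_k = k^(k-1) on arithmetic progressions of step -1, and the second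
   identity at e = (n-1, .., 0) is the theorem. *)

(** * Partial derivatives and integrals of polynomial functions *)

Section PolynomialIntegral.
Context {R : numFieldType}.
Implicit Types (p q : {poly R}) (f g : R -> R) (a b c : R).

(** In characteristic 0, a nonzero [p - q] would vanish at [size (p - q)] distinct natural numbers,
    more than its degree allows. *)
Lemma poly_horner_inj p q : (forall x, p.[x] = q.[x]) -> p = q.
Proof.
move=> pq; apply/eqP; rewrite -subr_eq0; apply/negPn/negP => nz.
have := max_poly_roots nz (rs := [seq i%:R | i <- iota 0 (size (p - q))]).
rewrite size_map size_iota ltnn => H; suff: false by [].
apply: H.
  by apply/allP => _ /mapP[i _ ->]; rewrite /root hornerD hornerN pq subrr.
by rewrite map_inj_uniq ?iota_uniq// => i j /eqP; rewrite eqr_nat => /eqP.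
Qed.

Lemma deriv_eq_horner p q a b :
  p^`() = q^`() -> p.[b] - p.[a] = q.[b] - q.[a].
Proof.
move=> dpq; suff -> : p = q + ((p - q)`_0)%:P.
  by rewrite !hornerD !hornerC; ring.
rewrite -[LHS](subrK q) addrC; congr (_ + _); apply/polyP => -[|i].
  by rewrite coefC eqxx.
rewrite coefC/=; have /(congr1 (fun r : {poly R} => r`_i)) : (p - q)^`() = 0.
  by rewrite derivB dpq subrr.
by rewrite coef_deriv coef0 => /eqP; rewrite mulrn_eq0/= => /eqP.
Qed.

(* For i = 0 the coefficient is a division by 0, hence 0. *)
Definition prim p : {poly R} := \poly_(i < (size p).+1) (p`_i.-1 / i%:R).

Lemma deriv_prim p : (prim p)^`() = p.
Proof.
apply/polyP => i; rewrite coef_deriv coef_poly ltnS.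
case: ltnP => /= [_|ip]; last by rewrite mul0rn nth_default.
by rewrite -[LHS]mulr_natr mulfVK// pnatr_eq0.
Qed.

(* 0 if [f] is not polynomial. *)
Definition pint f a b : R :=
  let P := prim (xget 0 [set p : {poly R} | f = horner p]) in P.[b] - P.[a].

Lemma pintE p a b : pint (horner p^`()) a b = p.[b] - p.[a].
Proof.
rewrite /pint; case: xgetP => [q _ /= eq_q|/(_ p^`())]; last by case.
apply: deriv_eq_horner; rewrite deriv_prim; apply: poly_horner_inj => x.
by rewrite -eq_q.
Qed.

Lemma pint_horner p a b : pint (horner p) a b = (prim p).[b] - (prim p).[a].
Proof. by rewrite -pintE deriv_prim. Qed.

Definition polyline f := exists p, f = horner p.

Lemma polyline0 : polyline (fun=> 0).
Proof. by exists 0; apply/funext => x; rewrite horner0. Qed.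

Lemma polylineD f g :
  polyline f -> polyline g -> polyline (fun s => f s + g s).
Proof.
by move=> -[p ->] [q ->]; exists (p + q); apply/funext => x; rewrite hornerD.
Qed.

Lemma polylineM f g :
  polyline f -> polyline g -> polyline (fun s => f s * g s).
Proof.
by move=> -[p ->] [q ->]; exists (p * q); apply/funext => x; rewrite hornerM.
Qed.

Lemma polyline_cst c : polyline (fun=> c).
Proof. by exists c%:P; apply/funext => x; rewrite hornerC. Qed.

Lemma polyline_id : polyline id.
Proof. by exists 'X; apply/funext => x; rewrite hornerX. Qed.

Lemma polyline_sum I (r : seq I) (P : pred I) (f : I -> R -> R) :
  (forall i, polyline (f i)) -> polyline (fun s => \sum_(i <- r | P i) f i s).
Proof.
move=> pf; elim: r => [|i r IH].
  by under eq_fun do rewrite big_nil; exact: polyline0.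
under eq_fun do rewrite big_cons; case: (P i) => //.
exact: polylineD.
Qed.

Lemma pintD f g a b : polyline f -> polyline g ->
  pint (fun s => f s + g s) a b = pint f a b + pint g a b.
Proof.
move=> -[p ->] [q ->]; rewrite !pint_horner.
have -> : (fun s => p.[s] + q.[s]) = horner (prim p + prim q)^`().
  by apply/funext => s; rewrite derivD !deriv_prim hornerD.
by rewrite pintE !hornerD; ring.
Qed.

Lemma pintZ c f a b : polyline f ->
  pint (fun s => c * f s) a b = c * pint f a b.
Proof.
move=> -[p ->]; rewrite pint_horner.
have -> : (fun s => c * p.[s]) = horner (c *: prim p)^`().
  by apply/funext => s; rewrite derivZ deriv_prim hornerZ.
by rewrite pintE !hornerZ; ring.
Qed.

Lemma pint_sum I (r : seq I) (P : pred I) (f : I -> R -> R) a b :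
  (forall i, polyline (f i)) ->
  pint (fun s => \sum_(i <- r | P i) f i s) a b =
  \sum_(i <- r | P i) pint (f i) a b.
Proof.
move=> pf; elim: r => [|i r IH].
  rewrite big_nil; under eq_fun do rewrite big_nil.
  have -> : (fun=> 0) = horner (0 : {poly R})^`().
    by apply/funext => s; rewrite deriv0 horner0.
  by rewrite pintE !horner0 subrr.
rewrite big_cons; under eq_fun do rewrite big_cons.
case: (P i) => //; rewrite pintD ?IH//; exact: polyline_sum.
Qed.

Lemma pint_translate c f a b : polyline f ->
  pint (fun s => f (s - c)) (a + c) (b + c) = pint f a b.
Proof.
move=> -[p ->]; rewrite pint_horner.
have -> : (fun s => p.[s - c]) = horner (prim p \Po ('X - c%:P))^`().
  apply/funext => s; rewrite deriv_comp deriv_prim derivB derivX derivC subr0.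
  by rewrite mulr1 horner_comp hornerXsubC.
by rewrite pintE !horner_comp !hornerXsubC !addrK.
Qed.

End PolynomialIntegral.

(** * Polynomial functions of a sequence of variables *)

Section Environments.
Context {R : numFieldType}.
Implicit Types (e : nat -> R) (F G H Q : (nat -> R) -> R) (s : R).

Definition upd e i s : nat -> R := fun k => if k == i then s else e k.
Definition skip i e : nat -> R := fun k => e (bump i k).
Definition tailn k e : nat -> R := fun i => e (k + i)%N.
(** The entries [i] and [i.+1] merge into [s]; for [s = e i] or [s = e i.+1] this amounts to
    deleting the other of the two. *)
Definition ins i s e := upd (skip i e) i s.

Lemma ins_fst i e : ins i (e i) e = skip i.+1 e.
Proof.
apply/funext => k; rewrite /ins /upd /skip /bump.
by case: eqP => [->|ki]; [rewrite ltnn|congr e; lia].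
Qed.

Lemma ins_snd i e : ins i (e i.+1) e = skip i e.
Proof.
apply/funext => k; rewrite /ins /upd /skip /bump.
by case: eqP => [->|//]; rewrite leqnn.
Qed.

Lemma insE i s e k :
  ins i s e k = if (k < i)%N then e k else if k == i then s else e k.+1.
Proof.
rewrite /ins /upd /skip /bump; case: ltngtP => //.
Qed.

Lemma skip_upd_bump j m e s : skip j (upd e (bump j m) s) = upd (skip j e) m s.
Proof. by apply/funext => k; rewrite /skip /upd (inj_eq (can_inj (bumpK j))). Qed.

Lemma skip_upd j e s : skip j (upd e j s) = skip j e.
Proof.
by apply/funext => k; rewrite /skip /upd eq_sym (negbTE (neq_bump _ _)).
Qed.

Lemma tailn_upd k m e s : tailn k (upd e (k + m) s) = upd (tailn k e) m s.
Proof. by apply/funext => i; rewrite /tailn /upd eqn_add2l. Qed.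

Lemma tailn_ins_lt k i s e : (i < k)%N -> tailn k (ins i s e) = tailn k.+1 e.
Proof.
move=> ik; apply/funext => m; rewrite /tailn insE.
by rewrite ifF ?ifF ?addSn//; lia.
Qed.

Lemma tailn_ins k i s e : tailn k (ins (k + i) s e) = ins i s (tailn k e).
Proof.
by apply/funext => m; rewrite /tailn !insE ltn_add2l eqn_add2l addnS.
Qed.

(** Only products with a single variable are generated, so each induction has one easy product case;
    [polyfunM] recovers general products. *)
Inductive polyfun : ((nat -> R) -> R) -> Prop :=
| polyfun_cst c : polyfun (fun=> c)
| polyfun_mulvar i F : polyfun F -> polyfun (fun e => e i * F e)
| polyfunD F G : polyfun F -> polyfun G -> polyfun (fun e => F e + G e).

Lemma polyfunM F G : polyfun F -> polyfun G -> polyfun (fun e => F e * G e).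
Proof.
move=> pF pG; elim: pF => [c|i F' _ IH|F1 F2 _ IH1 _ IH2].
- elim: pG => [d|i F' _ IH|F1 F2 _ IH1 _ IH2].
  + exact: polyfun_cst.
  + by under eq_fun do rewrite mulrCA; exact: polyfun_mulvar.
  + by under eq_fun do rewrite mulrDr; exact: polyfunD.
- by under eq_fun do rewrite -mulrA; exact: polyfun_mulvar.
- by under eq_fun do rewrite mulrDl; exact: polyfunD.
Qed.

Lemma polyfunB F G : polyfun F -> polyfun G -> polyfun (fun e => F e - G e).
Proof.
move=> pF pG; under eq_fun do rewrite -mulN1r.
by apply: polyfunD => //; apply: polyfunM => //; exact: polyfun_cst.
Qed.

Lemma polyfun_sum I (r : seq I) (P : pred I) (F : I -> (nat -> R) -> R) :
  (forall i, polyfun (F i)) -> polyfun (fun e => \sum_(i <- r | P i) F i e).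
Proof.
move=> pf; elim: r => [|i r IH].
  by under eq_fun do rewrite big_nil; exact: polyfun_cst.
under eq_fun do rewrite big_cons; case: (P i) => //.
exact: polyfunD.
Qed.

Lemma polyfun_rename F (r : nat -> nat) :
  polyfun F -> polyfun (fun e => F (fun k => e (r k))).
Proof.
elim => [c|i F' _ IH|F1 F2 _ IH1 _ IH2].
- exact: polyfun_cst.
- exact: (@polyfun_mulvar (r i) _ IH).
- exact: (polyfunD IH1 IH2).
Qed.

Lemma polyfun_line F i e : polyfun F -> polyline (fun s => F (upd e i s)).
Proof.
elim => [c|j F' _ IH|F1 F2 _ IH1 _ IH2].
- exact: polyline_cst.
- apply: polylineM => //; rewrite /upd; case: (j == i).
    exact: polyline_id.
  exact: polyline_cst.
- exact: polylineD.
Qed.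

(** An algebraic partial derivative: no limits occur, so that [R] can be any [numFieldType]. It is a
    relation, made functional by [partial_unique]. *)
Definition partial i F G := forall e, exists p : {poly R},
  (fun s => F (upd e i s)) = horner p /\
  (fun s => G (upd e i s)) = horner p^`().

Lemma partial_cst i F : (forall e s, F (upd e i s) = F e) ->
  partial i F (fun=> 0).
Proof.
move=> Fi e; exists (F e)%:P; split; apply/funext => s.
  by rewrite hornerC.
by rewrite derivC horner0.
Qed.

Lemma partial_var i : partial i (fun e => e i) (fun=> 1).
Proof.
move=> e; exists 'X; split; apply/funext => s; first by rewrite /upd eqxx hornerX.
by rewrite derivX hornerC.
Qed.

Lemma partialD i F F' G G' : partial i F F' -> partial i G G' ->
  partial i (fun e => F e + G e) (fun e => F' e + G' e).
Proof.
move=> FF GG e; have [p [p1 p2]] := FF e; have [q [q1 q2]] := GG e.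
exists (p + q); split; apply/funext => s.
  by rewrite hornerD -p1 -q1.
by rewrite derivD hornerD -p2 -q2.
Qed.

Lemma partialM i F F' G G' : partial i F F' -> partial i G G' ->
  partial i (fun e => F e * G e) (fun e => F' e * G e + F e * G' e).
Proof.
move=> FF GG e; have [p [p1 p2]] := FF e; have [q [q1 q2]] := GG e.
exists (p * q); split; apply/funext => s.
  by rewrite hornerM -p1 -q1.
by rewrite derivM hornerD !hornerM -p2 -q2 -p1 -q1.
Qed.

Lemma eq_partial i F F' G G' : F =1 G -> F' =1 G' ->
  partial i F F' -> partial i G G'.
Proof. by move=> /funext -> /funext ->. Qed.

Lemma partialZ i c F F' : partial i F F' ->
  partial i (fun e => c * F e) (fun e => c * F' e).
Proof.
move=> FF; have c0 : partial i (fun=> c) (fun=> 0) by exact: partial_cst.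
by apply: eq_partial (partialM c0 FF) => // e; rewrite mul0r add0r.
Qed.

Lemma partialB i F F' G G' : partial i F F' -> partial i G G' ->
  partial i (fun e => F e - G e) (fun e => F' e - G' e).
Proof.
move=> FF /(partialZ (-1)) GG.
by apply: eq_partial (partialD FF GG) => e; rewrite mulN1r.
Qed.

Lemma partial_sum i I (r : seq I) (P : pred I)
    (F F' : I -> (nat -> R) -> R) :
  (forall k, P k -> partial i (F k) (F' k)) ->
  partial i (fun e => \sum_(k <- r | P k) F k e)
            (fun e => \sum_(k <- r | P k) F' k e).
Proof.
move=> FF; elim: r => [|k r IH].
  apply: (@eq_partial _ (fun=> 0) (fun=> 0)) => [e|e|].
  - by rewrite big_nil.
  - by rewrite big_nil.
  - exact: partial_cst.
apply: (@eq_partial _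
  (fun e => (if P k then F k e else 0) + \sum_(k <- r | P k) F k e)
  (fun e => (if P k then F' k e else 0) + \sum_(k <- r | P k) F' k e))
  => [e|e|].
- by rewrite big_cons; case: (P k); rewrite ?add0r.
- by rewrite big_cons; case: (P k); rewrite ?add0r.
- by apply: partialD => //; case Pk: (P k); [exact: FF|exact: partial_cst].
Qed.

Lemma partial_unique i F G G' : partial i F G -> partial i F G' -> G = G'.
Proof.
move=> FG FG'; apply/funext => e.
have [p [p1 p2]] := FG e; have [q [q1 q2]] := FG' e.
have pq : p = q by apply: poly_horner_inj => x; rewrite -p1 -q1.
have eK : upd e i (e i) = e by apply/funext => k; rewrite /upd; case: eqP => [->|].
have /(congr1 (@^~ (e i))) := p2; have /(congr1 (@^~ (e i))) := q2.
by rewrite /= !eK pq => -> ->.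
Qed.

Lemma partial_skip j m F G : partial m F G ->
  partial (bump j m) (fun e => F (skip j e)) (fun e => G (skip j e)).
Proof.
move=> FG e; have [p [p1 p2]] := FG (skip j e).
by exists p; rewrite -p1 -p2; split; apply/funext => s; rewrite skip_upd_bump.
Qed.

Lemma partial_tailn k m F G : partial m F G ->
  partial (k + m) (fun e => F (tailn k e)) (fun e => G (tailn k e)).
Proof.
move=> FG e; have [p [p1 p2]] := FG (tailn k e).
by exists p; rewrite -p1 -p2; split; apply/funext => s; rewrite tailn_upd.
Qed.

Lemma partial_skip0 j F : partial j (fun e => F (skip j e)) (fun=> 0).
Proof. by apply: partial_cst => e s; rewrite skip_upd. Qed.

Lemma partial_exists F i : polyfun F ->
  exists2 G, polyfun G & partial i F G.
Proof.
elim=> [c|j F' pF' [G pG FG]|F1 F2 _ [G1 p1 d1] _ [G2 p2 d2]].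
- by exists (fun=> 0); [exact: polyfun_cst|exact: partial_cst].
- exists (fun e => (j == i)%:R * F' e + e j * G e).
    apply: polyfunD; last exact: polyfun_mulvar.
    by apply: polyfunM => //; exact: polyfun_cst.
  apply: partialM => //; case: eqP => [->|ji]; first exact: partial_var.
  by apply: partial_cst => e s; rewrite /upd ifF//; apply/eqP.
- by exists (fun e => G1 e + G2 e); [exact: polyfunD|exact: partialD].
Qed.

(** Symmetry of mixed derivatives, expressed by one common [C]; it allows differentiation under the
    sign of [slice_int]. *)
Lemma partial_comm F i j : polyfun F ->
  exists A B C, [/\ polyfun A, polyfun B, polyfun C &
   [/\ partial i F A, partial j F B, partial j A C & partial i B C]].
Proof.
elim=> [c|k F' pF' [A [B [C [pA pB pC [dA dB dAC dBC]]]]]|].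
- exists (fun=> 0), (fun=> 0), (fun=> 0).
  by split; try exact: polyfun_cst; split; exact: partial_cst.
- have dv m : partial m (fun e => e k) (fun=> (k == m)%:R).
    case: eqP => [->|ji]; first exact: partial_var.
    by apply: partial_cst => e s; rewrite /upd ifF//; apply/eqP.
  have pc c G : polyfun G -> polyfun (fun e => c * G e).
    by apply: polyfunM; exact: polyfun_cst.
  exists (fun e => (k == i)%:R * F' e + e k * A e).
  exists (fun e => (k == j)%:R * F' e + e k * B e).
  exists (fun e => (k == i)%:R * B e + ((k == j)%:R * A e + e k * C e)).
  split.
  + by apply: polyfunD; [exact: pc|exact: polyfun_mulvar].
  + by apply: polyfunD; [exact: pc|exact: polyfun_mulvar].
  + apply: polyfunD; first exact: pc.
    by apply: polyfunD; [exact: pc|exact: polyfun_mulvar].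
  + split; [exact: partialM|exact: partialM| |].
    * by apply: partialD; [exact: partialZ|exact: partialM].
    * apply: (eq_partial (fun=> erefl) _
        (partialD (partialZ _ dA) (partialM (dv i) dBC))) => e.
      by rewrite addrCA.
- move=> F1 F2 _ [A1 [B1 [C1 [? ? ? [? ? ? ?]]]]].
  move=> _ [A2 [B2 [C2 [? ? ? [? ? ? ?]]]]].
  exists (fun e => A1 e + A2 e), (fun e => B1 e + B2 e), (fun e => C1 e + C2 e).
  by split; try exact: polyfunD; split; exact: partialD.
Qed.

Lemma antiderivative_exists F i : polyfun F ->
  exists2 Q, polyfun Q & partial i Q F.
Proof.
(* The factor [e i ^+ r] strengthens the induction: multiplication by the variable [e i] itself only
   raises [r]. *)
move=> pF; suff /(_ 0%N)[Q pQ dQ] : forall r, exists2 Q, polyfun Q &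
    partial i Q (fun e => e i ^+ r * F e).
  by exists Q => //; apply: eq_partial dQ => // e; rewrite mul1r.
have pX r : polyfun (fun e => e i ^+ r).
  elim: r => [|r IH]; first exact: polyfun_cst.
  by under eq_fun do rewrite exprS; exact: polyfun_mulvar.
elim: pF => [c|j F' _ IH|F1 F2 _ IH1 _ IH2] r.
- exists (fun e => c / r.+1%:R * e i ^+ r.+1).
    by apply: polyfunM => //; exact: polyfun_cst.
  move=> e; exists ((c / r.+1%:R) *: 'X^(r.+1)); split; apply/funext => s.
    by rewrite /upd eqxx hornerZ hornerXn.
  rewrite /upd eqxx derivZ derivXn hornerZ hornerMn hornerXn/=.
  by rewrite -[s ^+ r *+ _]mulr_natr mulrCA mulfVK// pnatr_eq0.
- case: (eqVneq j i) => [->|ji].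
    have [Q pQ dQ] := IH r.+1; exists Q => //.
    by apply: eq_partial dQ => // e; rewrite exprSr mulrA.
  have [Q pQ dQ] := IH r; exists (fun e => e j * Q e).
    exact: polyfun_mulvar.
  have dj : partial i (fun e => e j) (fun=> 0).
    by apply: partial_cst => e s; rewrite /upd (negbTE ji).
  by apply: eq_partial (partialM dj dQ) => // e; rewrite mul0r add0r mulrCA.
- have [Q1 p1 d1] := IH1 r; have [Q2 p2 d2] := IH2 r.
  exists (fun e => Q1 e + Q2 e); first exact: polyfunD.
  by apply: eq_partial (partialD d1 d2) => // e; rewrite mulrDr.
Qed.

(* The integral of [F (e_0, .., e_(i-1), s, e_(i+2), ..)] for [s] from
   [e_(i+1)] to [e_i]. *)
Definition slice_int i F e := pint (fun s => F (ins i s e)) (e i.+1) (e i).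

(** Fundamental theorem of calculus; by [ins_fst] and [ins_snd], the merged sequences at the two
    bounds are deletions. *)
Lemma slice_int_primitive i Q F e : partial i Q F ->
  slice_int i F e = Q (skip i.+1 e) - Q (skip i e).
Proof.
move=> /(_ (skip i e))[p [p1 p2]]; rewrite /slice_int /ins p2 pintE -ins_fst -ins_snd.
have Qp s : Q (ins i s e) = p.[s] by rewrite -p1.
by rewrite !Qp.
Qed.

Lemma polyfun_slice_int i F : polyfun F -> polyfun (slice_int i F).
Proof.
move=> /(antiderivative_exists i)[Q pQ dQ].
have -> : slice_int i F = fun e => Q (skip i.+1 e) - Q (skip i e).
  by apply/funext => e; exact: slice_int_primitive.
by apply: polyfunB; exact: polyfun_rename.
Qed.

(** Differentiation under the integral sign: for [m != i], entry [m] of the merged sequence is entry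
    [bump i m] of [e], which is neither of the two bounds. *)
Lemma partial_slice_int m i F G : m != i -> polyfun F -> partial m F G ->
  partial (bump i m) (slice_int i F) (slice_int i G).
Proof.
move=> mi /(antiderivative_exists i)[Q pQ dQ] dG.
have [A [B [C [_ _ _ [dA dB dC dBC]]]]] := partial_comm i m pQ.
have AF := partial_unique dA dQ; rewrite {}AF in dC.
have CG := partial_unique dC dG; rewrite {}CG in dBC.
apply: eq_partial (fun e => esym (slice_int_primitive e dQ))
  (fun e => esym (slice_int_primitive e dBC)) _.
apply: partialB; last exact: partial_skip.
rewrite (_ : bump i m = bump i.+1 m); first exact: partial_skip.
by move/eqP : mi; rewrite /bump; lia.
Qed.

Lemma partial_slice_int_fst i F : polyfun F ->
  partial i (slice_int i F) (fun e => F (skip i.+1 e)).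
Proof.
move=> /(antiderivative_exists i)[Q pQ dQ].
apply: eq_partial (fun e => esym (slice_int_primitive e dQ)) (fun e => subr0 _) _.
apply: partialB; last exact: partial_skip0.
by rewrite [X in partial X](_ : i = bump i.+1 i); [|rewrite /bump; lia];
  exact: partial_skip.
Qed.

Lemma partial_slice_int_snd i F : polyfun F ->
  partial i.+1 (slice_int i F) (fun e => - F (skip i e)).
Proof.
move=> /(antiderivative_exists i)[Q pQ dQ].
apply: eq_partial (fun e => esym (slice_int_primitive e dQ)) (fun e => sub0r _) _.
apply: partialB; first exact: partial_skip0.
by rewrite [X in partial X](_ : i.+1 = bump i i); [exact: partial_skip|rewrite /bump; lia].
Qed.

Lemma slice_int_sum i I (r : seq I) (P : pred I) (c : I -> R)
    (F : I -> (nat -> R) -> R) e : (forall k, polyfun (F k)) ->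
  slice_int i (fun e => \sum_(k <- r | P k) c k * F k e) e =
  \sum_(k <- r | P k) c k * slice_int i (F k) e.
Proof.
move=> pF; rewrite /slice_int (pint_sum _ _ (f := fun k s => c k * F k (ins i s e))).
  by apply: eq_bigr => k _; rewrite pintZ//; exact: polyfun_line.
by move=> k; apply: polylineM; [exact: polyline_cst|exact: polyfun_line].
Qed.

End Environments.

(** * The volume polynomials *)

Section Recursion.
Context {R : numFieldType}.
Implicit Types (e : nat -> R).

(* Polynomial functions are functions of infinitely many variables: [W n] and
   [Perm n] only depend on the first n of them. [W n e] is the volume of Q(e). *)
Fixpoint W n : (nat -> R) -> R :=
  if n is n'.+1 then
    fun e => e n' * W n' e + \sum_(i < n') slice_int i (W n') e
  else fun=> 1.

(* [Perm 0 = 0] makes the recursion uniform and kills the terms of index 0 below. *)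
Fixpoint Perm n : (nat -> R) -> R :=
  if n is n'.+1 then
    fun e => (n' == 0%N)%:R + \sum_(i < n') slice_int i (Perm n') e
  else fun=> 0.

Arguments W : simpl never.
Arguments Perm : simpl never.

Lemma WS n e : W n.+1 e = e n * W n e + \sum_(i < n) slice_int i (W n) e.
Proof. by []. Qed.

Lemma PermS n e : Perm n.+1 e = (n == 0%N)%:R + \sum_(i < n) slice_int i (Perm n) e.
Proof. by []. Qed.

Lemma polyfun_W n : polyfun (W n).
Proof.
elim: n => [|n IH]; first exact: polyfun_cst.
apply: polyfunD; first exact: polyfun_mulvar.
by apply: polyfun_sum => i; exact: polyfun_slice_int.
Qed.

Lemma polyfun_Perm n : polyfun (Perm n).
Proof.
elim: n => [|n IH]; first exact: polyfun_cst.
apply: polyfunD; first exact: polyfun_cst.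
by apply: polyfun_sum => i; exact: polyfun_slice_int.
Qed.

Lemma slice_int_local n (F : (nat -> R) -> R) i e e' : (i < n)%N ->
  (forall a b, (forall k, (k < n)%N -> a k = b k) -> F a = F b) ->
  (forall k, (k < n.+1)%N -> e k = e' k) -> slice_int i F e = slice_int i F e'.
Proof.
move=> lt_in locF ee'; rewrite /slice_int !ee'; try lia.
congr (pint _ _ _); apply/funext => s; apply: locF => k kn.
by rewrite !insE !ee'//; lia.
Qed.

Lemma W_local n e e' : (forall k, (k < n)%N -> e k = e' k) -> W n e = W n e'.
Proof.
elim: n e e' => [//|n IH] e e' ee'; rewrite !WS ee'// (IH e e'); last first.
  by move=> k kn; apply: ee'; lia.
by congr (_ + _); apply: eq_bigr => i _; exact: (slice_int_local (n := n)).
Qed.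

Lemma Perm_local n e e' : (forall k, (k < n)%N -> e k = e' k) -> Perm n e = Perm n e'.
Proof.
elim: n e e' => [//|n IH] e e' ee'; rewrite !PermS.
by congr (_ + _); apply: eq_bigr => i _; exact: (slice_int_local (n := n)).
Qed.

Lemma Perm_ins k i s e : (k <= i)%N -> Perm k (ins i s e) = Perm k e.
Proof. by move=> ki; apply: Perm_local => m mk; rewrite insE ifT//; lia. Qed.

(* The derivative of [W n] in the direction that only moves the facets
   x_S = e_0 + .. + e_(k-1), |S| = k: such a facet is the product of a
   permutohedron and of a polymatroid. *)
Definition facet n k e : R := 'C(n, k)%:R * (Perm k e * W (n - k)%N (tailn k e)).

Lemma polyfun_facet n k : polyfun (facet n k).
Proof.
apply: polyfunM; first exact: polyfun_cst.
apply: polyfunM; first exact: polyfun_Perm.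
exact: polyfun_rename (polyfun_W _).
Qed.

Lemma facet0 n e : facet n 0 e = 0.
Proof. by rewrite /facet mul0r mulr0. Qed.

Lemma facet_gt n k e : (n < k)%N -> facet n k e = 0.
Proof. by move=> nk; rewrite /facet bin_small// mul0r. Qed.

(** For [i < k] the variable [s] is among the first [k] entries, so only the [Perm] factor is
    integrated. The tail starts at [k.+1] because two entries of [e] were merged before it. *)
Lemma slice_int_facet_lt n k i e : (i < k)%N ->
  slice_int i (facet n k) e = 'C(n, k)%:R * (slice_int i (Perm k) e * W (n - k)%N (tailn k.+1 e)).
Proof.
move=> ik; rewrite /slice_int.
have -> : (fun s => facet n k (ins i s e)) = (fun s =>
    ('C(n, k)%:R * W (n - k)%N (tailn k.+1 e)) * Perm k (ins i s e)).
  by apply/funext => s; rewrite /facet tailn_ins_lt//; ring.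
rewrite pintZ; last exact: polyfun_line (polyfun_Perm k).
by ring.
Qed.

Lemma slice_int_facet_ge n k i e :
  slice_int (k + i) (facet n k) e = 'C(n, k)%:R * (Perm k e * slice_int i (W (n - k)%N) (tailn k e)).
Proof.
rewrite /slice_int.
have -> : (fun s => facet n k (ins (k + i) s e)) = (fun s =>
    ('C(n, k)%:R * Perm k e) * W (n - k)%N (ins i s (tailn k e))).
  by apply/funext => s; rewrite /facet tailn_ins Perm_ins ?leq_addr// mulrA.
rewrite pintZ; last exact: polyfun_line (polyfun_W _).
by rewrite /tailn addnS mulrA.
Qed.

Lemma tailn1 e : tailn 1 e = skip 0 e.
Proof. by apply/funext => k; rewrite /tailn /skip /bump. Qed.

(* Pascal's rule; the first summand is expanded by the recursion of [Perm], the
   second one by that of [W]. *)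
Lemma facetS n k e : (k <= n)%N -> facet n.+1 k.+1 e =
  (k == 0%N)%:R * W n (skip 0 e) + \sum_(i < n | (i < k)%N) slice_int i (facet n k) e +
  (e n * facet n k.+1 e + \sum_(i < n | (k < i)%N) slice_int i (facet n k.+1) e).
Proof.
move=> kn; rewrite [facet n.+1 _ _]/facet binS natrD addrC mulrDl subSS.
congr (_ + _).
  rewrite PermS mulrDl mulrDr; congr (_ + _).
    by case: eqP => [->|_]; rewrite ?subn0 ?bin0 ?tailn1 /= ?mul1r ?mul0r ?mulr0.
  rewrite mulr_suml mulr_sumr (big_ord_widen n (fun i =>
    'C(n, k)%:R * (slice_int i (Perm k) e * W (n - k)%N (tailn k.+1 e))))//.
  by apply: eq_bigr => i ik; rewrite slice_int_facet_lt.
case: (ltnP n k.+1) => [nk|kn'].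
  rewrite bin_small// mul0r facet_gt// mulr0 big1 ?addr0// => i.
  by have := ltn_ord i; lia.
have -> : (n - k = (n - k.+1).+1)%N by lia.
rewrite WS [facet n k.+1 e]/facet !mulrDr; congr (_ + _).
  by rewrite {1}/tailn (_ : (k.+1 + (n - k.+1) = n)%N); [ring|lia].
rewrite !mulr_sumr -(big_mkord xpredT (fun i => 'C(n, k.+1)%:R *
  (Perm k.+1 e * slice_int i (W (n - k.+1)) (tailn k.+1 e)))).
rewrite -(big_mkord (fun i => k < i)%N (fun i => slice_int i (facet n k.+1) e)).
rewrite [RHS](@big_cat_nat _ _ _ k.+1)// [X in _ = X + _]big_nat_cond.
rewrite [X in _ = X + _]big1 ?add0r; last by move=> i ik; exfalso; lia.
rewrite -[X in \sum_(X <= _ < n | _) _]add0n big_addn; apply/esym; apply: congr_big_nat => // i.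
  by rewrite addnS ltnS leq_addl.
by rewrite addnC slice_int_facet_ge.
Qed.

(** If [i < k], the first [k] entries of the merged sequence come from [k.+1] entries of [e], hence
    the weight [c (k + (i < k))]. The weights used below are [(j < k)%:R], for the gradient, and
    [psum k e], for Euler's identity. *)
Lemma sum_facet (c : nat -> R) n e :
  \sum_(k < n.+2) c k * facet n.+1 k e =
  c 1%N * W n (skip 0 e) + e n * (\sum_(k < n.+1) c k * facet n k e) +
  \sum_(i < n) \sum_(k < n.+1) c (k + (i < k))%N * slice_int i (facet n k) e.
Proof.
have slice0 i : slice_int i (facet n 0) e = 0.
  have -> : facet n 0 = fun=> 0 by apply/funext => x; exact: facet0.
  by rewrite (@slice_int_primitive _ _ (fun=> 0)) ?subrr//; exact: partial_cst.
(* The terms with [k <= i] are reindexed by one, the term [k = 0] being 0, so that both sums carry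
   the weight [c k.+1] produced by [facetS]. *)
have split_i (i : 'I_n) :
    \sum_(k < n.+1) c (k + (i < k))%N * slice_int i (facet n k) e =
    \sum_(k < n.+1 | (i < k)%N) c k.+1 * slice_int i (facet n k) e +
    \sum_(k < n.+1 | (k < i)%N) c k.+1 * slice_int i (facet n k.+1) e.
  rewrite (bigID (fun k : 'I_n.+1 => i < k)%N)/=; congr (_ + _).
    by apply: eq_bigr => k ik; rewrite ik addn1.
  pose g k := c k * slice_int i (facet n k) e.
  transitivity (\sum_(k < n.+1 | (k <= i)%N) g k).
    apply: eq_big => k; first by rewrite -leqNgt.
    by move=> /negbTE ->; rewrite addn0.
  rewrite -(big_mkord (fun k => k <= i)%N g).
  rewrite -(big_mkord (fun k => k < i)%N (fun k => g k.+1)).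
  rewrite big_ltn_cond//= {1}/g slice0 mulr0 add0r.
  rewrite [RHS]big_mkcond big_nat_recr//= ifF ?addr0 -?big_mkcond/=.
    by rewrite big_add1.
  by have := ltn_ord i; lia.
rewrite (eq_bigr _ (fun i _ => split_i i)) big_split/=.
rewrite big_ord_recl facet0 mulr0 add0r.
have facetSk (k : 'I_n.+1) : c (lift ord0 k) * facet n.+1 (lift ord0 k) e =
    c k.+1 * ((k == 0%N :> nat)%:R * W n (skip 0 e)) +
    c k.+1 * (\sum_(i < n | (i < k)%N) slice_int i (facet n k) e) +
    (c k.+1 * (e n * facet n k.+1 e) +
     c k.+1 * (\sum_(i < n | (k < i)%N) slice_int i (facet n k.+1) e)).
  by rewrite lift0 facetS ?mulrDr// -ltnS.
rewrite (eq_bigr _ (fun k _ => facetSk k)) !big_split/=.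
have -> : \sum_(k < n.+1) c k.+1 * ((k == 0%N :> nat)%:R * W n (skip 0 e)) =
    c 1%N * W n (skip 0 e).
  by rewrite big_ord_recl/= mul1r big1 ?addr0// => k _; rewrite mul0r mulr0.
have -> : \sum_(k < n.+1) c k.+1 * (e n * facet n k.+1 e) =
    e n * \sum_(k < n.+1) c k * facet n k e.
  rewrite big_ord_recr/= facet_gt// !mulr0 addr0 big_ord_recl facet0 mulr0 add0r.
  by rewrite mulr_sumr; apply: eq_bigr => k _; rewrite mulrCA.
have -> : \sum_(k < n.+1) c k.+1 * (\sum_(i < n | (i < k)%N) slice_int i (facet n k) e) =
    \sum_(i < n) \sum_(k < n.+1 | (i < k)%N) c k.+1 * slice_int i (facet n k) e.
  rewrite (exchange_big_dep xpredT)//=; apply: eq_bigr => k _.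
  by rewrite mulr_sumr.
have -> : \sum_(k < n.+1) c k.+1 * (\sum_(i < n | (k < i)%N) slice_int i (facet n k.+1) e) =
    \sum_(i < n) \sum_(k < n.+1 | (k < i)%N) c k.+1 * slice_int i (facet n k.+1) e.
  rewrite (exchange_big_dep xpredT)//=; apply: eq_bigr => k _.
  by rewrite mulr_sumr.
by ring.
Qed.

(** The level e_0 + .. + e_(k-1) of a facet involves [e j] exactly when [j < k]; so this is the
    derivative of [W n] in [e j], as [partial_W] confirms. *)
Definition gradW n j e : R := \sum_(k < n.+1) (j < k)%:R * facet n k e.

(** Merging moves the index [j] to [j.-1] if [i < j]; in particular [i] and [i.+1] both become the
    merged entry [i]. *)
Lemma gradWS n j e : gradW n.+1 j e =
  (j == 0%N)%:R * W n (skip 0 e) + e n * gradW n j e +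
  \sum_(i < n) slice_int i (gradW n (if i < j then j.-1 else j)%N) e.
Proof.
rewrite /gradW (sum_facet (fun k => (j < k)%:R)) ltnS leqn0; congr (_ + _).
apply: eq_bigr => i _; rewrite slice_int_sum; last by move=> k; exact: polyfun_facet.
apply: eq_bigr => k _; congr (_%:R * _); congr nat_of_bool.
by case: (ltnP i j); case: (ltnP i k) => /=; lia.
Qed.

Lemma partial_W n j : partial j (W n) (gradW n j).
Proof.
elim: n j => [|n IH] j.
  apply: eq_partial (fun=> erefl) _ (partial_cst (F := W 0) _) => // e.
  by rewrite /gradW big_ord1 mul0r.
pose d i e : R := slice_int i (gradW n (if i < j then j.-1 else j)%N) e +
  ((j == i)%:R - (j == i.+1)%:R) * W n (skip j e).
have dJ i : partial j (slice_int i (W n)) (d i).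
  case: (ltngtP j i) => [ji|ij|ji].
  - rewrite (_ : partial j = partial (bump i j)); last first.
      by rewrite /bump leqNgt ji.
    apply: eq_partial (fun=> erefl) _ (partial_slice_int _ (polyfun_W n) (IH j)).
      move=> e; rewrite /d ltnNge (ltnW ji)/=.
      have [-> ->] : (j == i) = false /\ (j == i.+1) = false by lia.
      by rewrite subrr mul0r addr0.
    by rewrite neq_ltn ji.
  - case: (eqVneq j i.+1) => [ji|ji1].
      rewrite {1}ji; apply: eq_partial (fun=> erefl) _ (partial_slice_int_snd i (polyfun_W n)) => e.
      rewrite /d ij ji/= (slice_int_primitive e (IH i)) eqxx.
      have -> : (i.+1 == i) = false by lia.
      by rewrite /=; ring.
    have [m jm] : exists m, j = m.+1 by exists j.-1; lia.
    rewrite (_ : partial j = partial (bump i m)); last first.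
      by congr partial; rewrite /bump; lia.
    apply: eq_partial (fun=> erefl) _ (partial_slice_int _ (polyfun_W n) (IH m)).
      move=> e; rewrite /d ij jm/= -jm (negbTE ji1).
      have -> : (j == i) = false by lia.
      by rewrite subrr mul0r addr0.
    by apply/eqP; lia.
  - rewrite {1}ji; apply: eq_partial (fun=> erefl) _ (partial_slice_int_fst i (polyfun_W n)) => e.
    rewrite /d ji ltnn/= (slice_int_primitive e (IH i)) eqxx.
    have -> : (i == i.+1) = false by lia.
    by rewrite /=; ring.
have dn : partial j (fun e => e n) (fun=> (j == n)%:R : R).
  case: eqP => [->|jn]; first exact: partial_var.
  by apply: partial_cst => e s; rewrite /upd ifF//; apply/eqP => nj; exact: jn.
have dW := partialD (partialM dn (IH j))
  (partial_sum (index_enum 'I_n) (P := xpredT) (fun (i : 'I_n) _ => dJ i)).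
apply: eq_partial dW => e; first by rewrite WS.
rewrite gradWS.
have -> : \sum_(i < n) d i e =
    \sum_(i < n) slice_int i (gradW n (if i < j then j.-1 else j)%N) e +
    (\sum_(i < n) (j == i)%:R - \sum_(i < n) (j == i.+1)%:R) * W n (skip j e).
  by rewrite big_split/= -mulr_suml; congr (_ + _ * _); rewrite sumrB.
have -> : \sum_(i < n) (j == i)%:R = (j < n)%:R :> R.
  case: ltnP => jn.
    rewrite (bigD1 (Ordinal jn))//= eqxx big1 ?addr0// => i.
    by rewrite -val_eqE/= eq_sym => /negbTE ->.
  rewrite big1// => i _; case: eqP => // ji; exfalso.
  by have := ltn_ord i; lia.
have -> : \sum_(i < n) (j == i.+1)%:R = (0 < j <= n)%:R :> R.
  case: j {dJ dn d} => [|j]; first by rewrite big1.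
  rewrite ltn0Sn /=; case: (ltnP j n) => jn.
    rewrite (bigD1 (Ordinal jn))//= eqxx big1 ?addr0// => i.
    by rewrite -val_eqE/= eqSS eq_sym => /negbTE ->.
  rewrite big1// => i _; case: eqP => // ji; exfalso.
  by have := ltn_ord i; lia.
have Wn : W n (skip n e) = W n e.
  by apply: W_local => k kn; rewrite /skip /bump leqNgt kn.
(* The corrections cancel for [0 < j < n]. At [j = 0 < n] the remaining +1 is the first term of
   [gradWS]; at [j = n > 0] the remaining -1 cancels the derivative of the coefficient [e n]. *)
case: (ltngtP j n) => [jn|nj|->]; last first.
- by case: (n) Wn => [|m] -> /=; ring.
- by rewrite (_ : (j == 0%N) = false) ?andbF/=; [ring|lia].
- by case: j jn {dJ dn d} => [|j] jn /=; ring.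
Qed.

Definition psum k e : R := \sum_(i < k) e i.

Lemma psum_ins i s e k : psum (k + (i < k))%N e =
  psum k (ins i s e) + (i < k)%:R * (e i + e i.+1 - s).
Proof.
elim: k => [|k IH]; first by rewrite /psum !big_ord0 mul0r addr0.
rewrite /psum [in RHS]big_ord_recr/= -/(psum k _) insE ltnS.
case: (ltngtP k i) IH => [ki|ik|->]/=.
- rewrite !addn0 => IH.
  by rewrite big_ord_recr/= -/(psum _ _) IH; ring.
- by rewrite !addn1 => IH; rewrite big_ord_recr/= -/(psum _ _) IH; ring.
- by rewrite addn0 addn1 => IH; rewrite !big_ord_recr/= -/(psum _ _) IH; ring.
Qed.

(** Euler's identity for a homogeneous polynomial of degree [n]: by the form of [gradW], the left
    side is the sum over [j < n] of [e j] times the derivative in [e j]. *)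
Lemma euler_W n e : \sum_(k < n.+1) psum k e * facet n k e = n%:R * W n e.
Proof.
elim: n e => [|n IH] e; first by rewrite big_ord1 facet0 mulr0 mul0r.
rewrite (sum_facet (psum^~ e)) IH.
have JE (i : 'I_n) :
    \sum_(k < n.+1) psum (k + (i < k))%N e * slice_int i (facet n k) e =
    n.+1%:R * slice_int i (W n) e +
    (e i.+1 * W n (skip i.+1 e) - e i * W n (skip i e)).
  rewrite -slice_int_sum; last by move=> k; exact: polyfun_facet.
  have [p [p1 p2]] := partial_W n i (skip i e).
  have Wp s : W n (ins i s e) = p.[s] by rewrite -p1.
  have Gp s : gradW n i (ins i s e) = p^`().[s] by rewrite -p2.
  rewrite -ins_fst -ins_snd /slice_int.
  have -> : (fun s => W n (ins i s e)) = horner p by apply/funext.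
  rewrite pint_horner !Wp.
  (* By [psum_ins] and the induction hypothesis the integrand is n p(s) + (e_i + e_(i+1) - s) p'(s),
     which integrates by parts. The factor in front of p takes the values e_(i+1) and e_i at the
     bounds, so the boundary terms telescope in [i]. *)
  have -> : (fun s => \sum_(k < n.+1) psum (k + (i < k))%N e * facet n k (ins i s e)) =
      horner (n.+1%:R *: prim p + ((e i + e i.+1)%:P - 'X) * p)^`().
    apply/funext => s.
    transitivity (\sum_(k < n.+1) psum k (ins i s e) * facet n k (ins i s e) +
      (e i + e i.+1 - s) * gradW n i (ins i s e)).
      rewrite /gradW mulr_sumr -big_split/=; apply: eq_bigr => k _.
      by rewrite (psum_ins i s)/=; ring.
    rewrite IH Wp Gp.
    rewrite derivD derivZ deriv_prim derivM derivB derivC derivX.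
    by rewrite sub0r !(hornerD, hornerN, hornerM, hornerC, hornerX, hornerZ) -natr1; ring.
  by rewrite pintE !(hornerD, hornerN, hornerM, hornerC, hornerX, hornerZ); ring.
rewrite (eq_bigr _ (fun i _ => JE i)) big_split/= -mulr_sumr.
rewrite -(big_mkord xpredT (fun i => e i.+1 * W n (skip i.+1 e) - e i * W n (skip i e))).
rewrite (telescope_sumr (fun i => e i * W n (skip i e)))// WS.
have -> : W n (skip n e) = W n e.
  by apply: W_local => k kn; rewrite /skip /bump leqNgt kn.
by rewrite /psum big_ord1 -natr1; ring.
Qed.

Lemma gradW_last n e : gradW n.+1 n e = Perm n.+1 e.
Proof.
rewrite /gradW big_ord_recr/= big1 ?add0r => [|k _].
  by rewrite ltnSn mul1r /facet subnn binn mul1r mulr1.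
by rewrite ltnNge -ltnS ltn_ord mul0r.
Qed.

(** The derivative of [euler_W] for [n.+1] in the last entry [e n]. For [k <= n] only the [W] factor
    depends on it, with derivative [Perm] by [gradW_last]; for [k = n.+1] the unknown derivative of
    [Perm n.+1] has the coefficient [psum n.+1 e = 0]. *)
Lemma euler_Perm n e : psum n.+1 e = 0 ->
  n%:R * Perm n.+1 e =
  \sum_(k < n.+1) psum k e * ('C(n.+1, k)%:R * (Perm k e * Perm (n.+1 - k)%N (tailn k e))).
Proof.
move=> fn0.
have indep (F : (nat -> R) -> R) k : (k <= n)%N ->
    (forall a b, (forall i, (i < k)%N -> a i = b i) -> F a = F b) ->
    partial n F (fun=> 0).
  move=> kn Fk; apply: partial_cst => x s; apply: Fk => i ik.
  by rewrite /upd ifF//; apply/eqP; lia.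
have [D pD dD] := partial_exists n (polyfun_Perm n.+1).
have dpsum : partial n (psum n.+1) (fun=> 1).
  have d0 : partial n (psum n) (fun=> 0).
    apply: (indep _ n) => // a b ab; apply: eq_bigr => i _; exact: ab.
  apply: eq_partial (partialD d0 (partial_var n)) => x.
    by rewrite /psum big_ord_recr.
  by rewrite add0r.
have dk (k : 'I_n.+1) : partial n (fun x => psum k x * facet n.+1 k x)
    (fun x => psum k x * ('C(n.+1, k)%:R * (Perm k x * Perm (n.+1 - k)%N (tailn k x)))).
  have kn : (k <= n)%N by rewrite -ltnS ltn_ord.
  have d1 : partial n (psum k) (fun=> 0).
    by apply: (indep _ k) => // a b ab; apply: eq_bigr => i _; exact: ab.
  have d2 : partial n (Perm k) (fun=> 0).
    by apply: (indep _ k) => // a b; exact: Perm_local.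
  have d3 : partial n (fun x => W (n.+1 - k)%N (tailn k x))
      (fun x => Perm (n.+1 - k)%N (tailn k x)).
    have -> : partial n = partial (k + (n - k))%N by rewrite subnKC.
    apply: partial_tailn; rewrite subSn//.
    by apply: eq_partial (fun=> erefl) _ (partial_W _ _) => x; exact: gradW_last.
  apply: eq_partial (fun=> erefl) _
    (partialM d1 (partialZ 'C(n.+1, k)%:R (partialM d2 d3))) => x.
  by ring.
have dn : partial n (fun x => psum n.+1 x * facet n.+1 n.+1 x)
    (fun x => Perm n.+1 x + psum n.+1 x * D x).
  apply: eq_partial (partialM dpsum dD) => x.
    by rewrite /facet subnn binn mul1r mulr1.
  by rewrite mul1r.
have dE := partialD
  (partial_sum (index_enum 'I_n.+1) (P := xpredT) (fun k _ => dk k)) dn.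
have dW := partialZ n.+1%:R (partial_W n.+1 n).
have {}dE : partial n (fun x => n.+1%:R * W n.+1 x) (fun x =>
    \sum_(k < n.+1) psum k x * ('C(n.+1, k)%:R *
      (Perm k x * Perm (n.+1 - k)%N (tailn k x))) + (Perm n.+1 x + psum n.+1 x * D x)).
  by apply: eq_partial dE => // x; rewrite -euler_W [in RHS]big_ord_recr.
have /(congr1 (@^~ e)) := partial_unique dW dE.
by rewrite /= gradW_last fn0 mul0r addr0 -natr1 mulrDl mul1r => /addIr.
Qed.

(** Unlike that of [W], the recursion has no term with factor [e n]: its integrals run between
    entries of [e] and move along with them. *)
Lemma Perm_translate c n e : Perm n (fun k => e k + c) = Perm n e.
Proof.
elim: n e => [//|n IH] e; rewrite !PermS; congr (_ + _).
apply: eq_bigr => i _; rewrite /slice_int -[RHS](pint_translate c); last first.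
  exact: polyfun_line (polyfun_Perm n).
congr (pint _ _ _); apply/funext => s; rewrite -[RHS]IH; congr (Perm n _).
apply/funext => k; rewrite !insE; case: ifP => // _; case: ifP => // _.
by rewrite subrK.
Qed.

End Recursion.

(** * Abel's identity and the values on arithmetic progressions *)

Section Abel.
Context {R : numFieldType}.

(** An [n]-th finite difference kills degrees below [n]: Pascal's rule reduces it to a lower
    difference of p(X) - p(X + 1), whose degree is smaller because the leading terms cancel. *)
Lemma alternating_binomial_sum n (p : {poly R}) : (size p <= n)%N ->
  \sum_(k < n.+1) (-1) ^+ k * 'C(n, k)%:R * p.[k%:R] = 0.
Proof.
elim: n p => [|n IH] p.
  rewrite leqn0 size_poly_eq0 => /eqP ->.
  by rewrite big_ord1 horner0 mulr0.
move=> sp; pose q := p - (p \Po ('X + 1)).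
have sq : (size q <= n)%N.
  case: (eqVneq p 0) => [p0|p0].
    by rewrite /q p0 comp_poly0 subrr size_poly0.
  have sX : size ('X + 1 : {poly R}) = 2%N by rewrite -[1]opprK -polyCN size_XsubC.
  have lX : lead_coef ('X + 1 : {poly R}) = 1.
    by rewrite -[1]opprK -polyCN lead_coefXsubC.
  have spX : size (p \Po ('X + 1)) = size p by rewrite size_comp_poly2.
  apply/leq_sizeP => j nj; rewrite coefB.
  have [sj|js] := leqP (size p) j.
    by rewrite !nth_default ?subrr// spX.
  have -> : j = (size p).-1 by lia.
  rewrite -/(lead_coef p) -spX -/(lead_coef _) lead_coef_comp ?sX//.
  by rewrite lX expr1n mulr1 subrr.
transitivity (p.[0] + \sum_(k < n.+1) ((-1) ^+ k.+1 * 'C(n, k.+1)%:R * p.[k.+1%:R] +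
    (-1) ^+ k.+1 * 'C(n, k)%:R * p.[k.+1%:R])).
  rewrite big_ord_recl expr0 bin0 !mul1r; congr (_ + _).
  by apply: eq_bigr => k _; rewrite lift0 binS natrD mulrDr mulrDl.
rewrite big_split/= addrA.
have -> : p.[0] + \sum_(k < n.+1) (-1) ^+ k.+1 * 'C(n, k.+1)%:R * p.[k.+1%:R] =
    \sum_(k < n.+1) (-1) ^+ k * 'C(n, k)%:R * p.[k%:R].
  rewrite big_ord_recr/= bin_small// mulr0 mul0r addr0.
  by rewrite [RHS]big_ord_recl/= expr0 bin0 !mul1r.
rewrite -big_split/= -[RHS](IH q sq); apply: eq_bigr => k _.
rewrite /q hornerD hornerN horner_comp !hornerE/= exprS -natr1.
by ring.
Qed.

(** A form of Abel's binomial theorem. In the step to [n.+1] with [n > 0], both sides have the same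
    derivative, [n.+1] times the previous case at X + 1, and both vanish at X = -(n + 1), the left
    one by [alternating_binomial_sum] for X^n. *)
Lemma abel_poly n : \sum_(1 <= k < n.+1)
   ('C(n, k) * k ^ k.-1)%:R *: ('X + (n - k)%:R%:P) ^+ (n - k) =
  n%:R *: ('X + n%:R%:P) ^+ n.-1 :> {poly R}.
Proof.
elim: n => [|n IH]; first by rewrite big_geq// scale0r.
case: (posnP n) => [->|n0].
  by rewrite big_nat1 !expr0 binn muln1.
set L := LHS; set U := RHS.
have dLU : L^`() = U^`().
  rewrite /L /U raddf_sum/= derivZ deriv_exp derivD derivX derivC addr0 mul1r.
  rewrite big_nat_recr//= subnn expr0 derivZ derivC scaler0 addr0.
  transitivity (n.+1%:R *: ((\sum_(1 <= k < n.+1)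
     ('C(n, k) * k ^ k.-1)%:R *: ('X + (n - k)%:R%:P) ^+ (n - k) : {poly R}) \Po ('X + 1))).
    rewrite raddf_sum/= scaler_sumr; apply: eq_big_nat => k /andP[k1 kn].
    rewrite derivZ deriv_exp derivD derivX derivC addr0 mul1r comp_polyZ.
    rewrite rmorphXn/= comp_polyD comp_polyX comp_polyC.
    have nk : (n.+1 - k = (n - k).+1)%N by lia.
    rewrite nk /= -[_ ^+ _ *+ _]scaler_nat !scalerA -!natrM; congr (_ *: _).
      by congr _%:R; have := mul_bin_down n.+1 k; rewrite /= nk; nia.
    by rewrite -addrA -natr1 polyCD [1 + _]addrC.
  rewrite IH comp_polyZ rmorphXn/= comp_polyD comp_polyX comp_polyC.
  have -> : 'X + 1 + n%:R%:P = 'X + n.+1%:R%:P :> {poly R}.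
    by rewrite -addrA -natr1 polyCD [1 + _]addrC.
  by congr (_ *: _); rewrite scaler_nat.
have U0 : U.[- n.+1%:R] = 0.
  by rewrite hornerZ horner_exp hornerD hornerX hornerC addNr expr0n gtn_eqF ?mulr0.
have L0 : L.[- n.+1%:R] = 0.
  have sX : (size ('X^n : {poly R})%R <= n.+1)%N by rewrite size_polyXn.
  have alt : \sum_(k < n.+1) (-1) ^+ k.+1 * 'C(n.+1, k.+1)%:R * k.+1%:R ^+ n = 0 :> R.
    have := alternating_binomial_sum sX.
    rewrite big_ord_recl hornerXn expr0n gtn_eqF// mulr0 add0r => H; rewrite -[RHS]H.
    by apply: eq_bigr => k _; rewrite lift0 hornerXn.
  rewrite /L horner_sum big_add1 big_mkord.
  rewrite -[RHS](mulr0 ((-1) ^+ n.+1)) -[in RHS]alt mulr_sumr.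
  apply: eq_bigr => k _; rewrite hornerZ horner_exp hornerD hornerX hornerC subSS.
  have kn : (k <= n)%N by rewrite -ltnS.
  have -> : - n.+1%:R + (n - k)%:R = - 1 * k.+1%:R :> R.
    by rewrite natrB// -!natr1; ring.
  rewrite exprMn natrM natrX/=.
  have -> : (-1) ^+ n.+1 = (-1) ^+ (n - k) * (-1) ^+ k.+1 :> R.
    by rewrite -exprD; congr (_ ^+ _); lia.
  have -> : k.+1%:R ^+ n = k.+1%:R ^+ k * k.+1%:R ^+ (n - k) :> R.
    by rewrite -exprD subnKC.
  set u := (-1) ^+ k.+1; have uu : u * u = 1 by rewrite -expr2 sqrr_sign.
  rewrite [RHS](_ : _ = (u * u) * ('C(n.+1, k.+1)%:R * k.+1%:R ^+ k *
    ((-1) ^+ (n - k) * k.+1%:R ^+ (n - k)))); last by ring.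
  by rewrite uu mul1r.
apply: poly_horner_inj => x.
by have := deriv_eq_horner (- n.+1%:R) x dLU; rewrite U0 L0 !subr0.
Qed.

(** Writing n = k + (n - k) splits the left side into two sums, equal under the symmetry of k and n
    - k; each is [abel_poly] at 0 without the term k = n. *)
Lemma abel_sum n : (0 < n)%N ->
  n%:R * (\sum_(1 <= k < n)
    'C(n, k)%:R * (k%:R ^+ k.-1 * (n - k)%:R ^+ (n - k).-1)) =
  2 * (n%:R - 1) * n%:R ^+ n.-1 :> R.
Proof.
move=> n0; set F := (X in \sum_(1 <= k < n) X k).
have Fsym k : (k <= n)%N -> F (n - k)%N = F k.
  by move=> kn; rewrite /F bin_sub// subKn// [X in _ * X]mulrC.
have S : \sum_(1 <= k < n) (n - k)%:R * F k = (n%:R - 1) * n%:R ^+ n.-1.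
  have /(congr1 (horner^~ 0)) := abel_poly n.
  rewrite horner_sum hornerZ horner_exp hornerD hornerX hornerC add0r.
  rewrite big_nat_recr//= hornerZ subnn expr0 hornerC mulr1 binn mul1n natrX.
  move=> /(canRL (addrK _)); rewrite mulrBl mul1r => <-.
  apply: eq_big_nat => k /andP[k1 kn]; rewrite hornerZ horner_exp hornerD hornerX.
  rewrite hornerC add0r natrM natrX /F.
  have -> : (n - k = (n - k).-1.+1)%N by lia.
  by rewrite exprS/=; ring.
have S' : \sum_(1 <= k < n) k%:R * F k = (n%:R - 1) * n%:R ^+ n.-1.
  rewrite -S big_nat_rev/=; apply: eq_big_nat => k /andP[k1 kn].
  by rewrite add1n subSS Fsym// ltnW.
rewrite -mulrA [RHS]mulr_natl mulr2n -{1}S -S' -big_split/= mulr_sumr.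
apply: eq_big_nat => k /andP[k1 kn]; by rewrite -mulrDl -natrD subnK// ltnW.
Qed.

(** The value n^(n-2) of the regular permutohedron, Cayley's number of labelled trees; multiplying
    by [n] avoids a negative exponent at n = 1. *)
Lemma Perm_arith n a : (0 < n)%N ->
  n%:R * Perm n (fun k => a - k%:R) = n%:R ^+ n.-1 :> R.
Proof.
elim/ltn_ind: n a => -[//|n] IH a _.
case: (posnP n) => [->|n0].
  by rewrite PermS big_ord0 addr0 expr0 mulr1.
(* The translate for which the [n.+1] entries c, c - 1, .., c - n add up to 0, as [euler_Perm]
   requires. *)
pose c : R := n%:R / 2.
rewrite (_ : (fun k => a - k%:R) = (fun k : nat => (c - k%:R) + (a - c))); last first.
  by apply/funext => k; ring.
rewrite Perm_translate.
have psumE k : psum k (fun k : nat => c - k%:R) = k%:R * (n.+1%:R - k%:R) / 2.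
  elim: k => [|k IHk]; first by rewrite /psum big_ord0 !mul0r.
  move: IHk; rewrite /psum big_ord_recr/= => ->; rewrite /c -!natr1.
  by field.
have := @euler_Perm _ n (fun k : nat => c - k%:R).
rewrite psumE subrr mulr0 mul0r => /(_ erefl).
rewrite -(big_mkord xpredT (fun k => psum k (fun k : nat => c - k%:R) *
  ('C(n.+1, k)%:R * (Perm k (fun k : nat => c - k%:R) *
   Perm (n.+1 - k)%N (tailn k (fun k : nat => c - k%:R)))))).
(* Without the term [k = 0], both [k] and [n.+1 - k] lie between 1 and [n], and the induction
   hypothesis evaluates both [Perm] factors. *)
rewrite big_ltn// psumE !mul0r add0r => H.
have n1 : n%:R != 0 :> R by rewrite pnatr_eq0 -lt0n.
have n2 : n.+1%:R != 0 :> R by rewrite pnatr_eq0.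
apply: (mulfI n1); apply: (mulfI n2).
rewrite [X in _ * X]mulrCA {}H.
have := @abel_sum n.+1 isT; rewrite -[n.+1%:R in X in _ * X * _]natr1 addrK /= => A.
have -> : n.+1%:R * (n%:R * n.+1%:R ^+ n) =
  n.+1%:R * (2 * n%:R * n.+1%:R ^+ n) / 2 :> R by field.
rewrite -A -!mulrA; congr (_ * (_ * _)).
rewrite mulr_suml; apply: eq_big_nat => k /andP[k1 kn].
have nk : (0 < n.+1 - k)%N by lia.
have -> : tailn k (fun k : nat => c - k%:R) = (fun i : nat => (c - k%:R) - i%:R).
  by apply/funext => i; rewrite /tailn natrD; ring.
rewrite psumE -(IH k kn c k1) -(IH (n.+1 - k)%N _ (c - k%:R) nk); last by lia.
by rewrite natrB; [field|exact: ltnW].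
Qed.

Definition staircase n : nat -> R := fun k => n%:R - 1 - k%:R.

(** This is [euler_W] with n - k in place of k: the entries from index n - k on form the staircase
    of length k, and the first n - k entries add up to (n - k)(n + k - 1)/2, whose factor n - k goes
    into [Perm_arith]. *)
Lemma W_staircase n : n%:R * W n (staircase n) =
  \sum_(0 <= k < n) 'C(n, k)%:R *
    ((n - k)%:R ^+ (n - k).-1 * (n%:R + k%:R - 1) / 2) * W k (staircase k).
Proof.
have psumE k : psum k (staircase n) = k%:R * (2 * n%:R - k%:R - 1) / 2.
  elim: k => [|k IHk]; first by rewrite /psum big_ord0 !mul0r.
  move: IHk; rewrite /psum big_ord_recr/= => ->; rewrite /staircase -!natr1.
  by field.
rewrite -euler_W -(big_mkord xpredT (fun k => psum k (staircase n) *
  facet n k (staircase n))).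
rewrite big_ltn// facet0 mulr0 add0r big_add1 big_nat_rev/= add0n.
apply: eq_big_nat => k /andP[_ kn]; have kn' := ltnW kn; rewrite -subSn// subSS psumE /facet.
have -> : tailn (n - k)%N (staircase n) = staircase k.
  by apply/funext => i; rewrite /tailn /staircase natrD natrB//; ring.
rewrite bin_sub// subKn// -(@Perm_arith (n - k)%N (n%:R - 1)) ?subn_gt0//.
by rewrite natrB//; field.
Qed.

End Abel.

(** * Polymatroids and parking functions *)

Section Polymatroid.
Context {R : realFieldType}.
Implicit Types (e x : nat -> R) (s t : R).

Definition decreasing n e :=
  (forall i, (i.+1 < n)%N -> e i.+1 <= e i) /\ (forall i, (i < n)%N -> 0 <= e i).

Definition poly_ineq n e x :=
  (forall i, (i < n)%N -> 0 <= x i) /\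
  (forall m : nat -> bool,
    \sum_(i < n | m i) x i <= psum (\sum_(i < n) m i) e).

(** For decreasing [e], the intervals from [low n e i] to [e i] cover the range [[0, e 0]] of the
    first coordinate. *)
Definition low n e i : R := if i == n then 0 else e i.+1.

Definition consf t x : nat -> R := fun i => if i is i'.+1 then x i' else t.

Lemma consfE x : x = consf (x 0%N) (fun i => x i.+1).
Proof. by apply/funext => -[]. Qed.

Lemma decreasing_le n e i j : decreasing n e -> (i <= j < n)%N -> e j <= e i.
Proof.
move=> [de _]; elim: j => [|j IH] /andP[ij jn].
  by move: ij; rewrite leqn0 => /eqP ->.
move: ij; rewrite leq_eqVlt => /orP[/eqP -> //|ij].
by apply: le_trans (IH _); [exact: de|lia].
Qed.

Lemma decreasing_low n e i : decreasing n.+1 e -> (i <= n)%N ->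
  0 <= low n e i <= e i.
Proof.
move=> [de e0] iln; rewrite /low; case: eqP => [->|iN].
  by rewrite lexx e0.
by rewrite de ?e0//; lia.
Qed.

Lemma decreasing_ins n e i s : decreasing n.+1 e -> (i <= n)%N ->
  ((i < n)%N -> e i.+1 <= s <= e i) -> decreasing n (ins i s e).
Proof.
move=> ed iln hs; have [de e0] := ed; split=> k kn; rewrite !insE.
  case: (ltngtP k.+1 i) => [ki|ik|ki].
  - by apply: de; lia.
  - case: eqP => [ki|_]; last by apply: de; lia.
    have /andP[h _] := hs ltac:(lia).
    by apply: le_trans h; rewrite -ki; apply: de; lia.
  - have /andP[_ h] := hs ltac:(lia).
    by apply: le_trans h _; rewrite -ki; apply: de; lia.
case: ltngtP => [ki|ik|ki]; try by apply: e0; lia.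
have /andP[h _] := hs ltac:(lia).
by apply: le_trans h; apply: e0; lia.
Qed.

Lemma exists_low n e t : decreasing n.+1 e -> 0 <= t <= e 0%N ->
  exists2 i, (i <= n)%N & low n e i <= t <= e i.
Proof.
move=> [de e0] /andP[t0 te].
suff H k : (k <= n)%N -> t <= e k -> exists2 i, (i <= n)%N & low n e i <= t <= e i.
  exact: (H 0%N).
elim: {k}(n - k)%N {-2}k (erefl (n - k)%N) => [|m IH] k nk kn tk.
  have kE : k = n by lia.
  by exists n => //; rewrite /low eqxx t0 -kE.
case: (lerP t (e k.+1)) => [tk1|/ltW tk1].
  by apply: (IH k.+1) => //; lia.
by exists k => //; rewrite /low ifF ?tk1//; apply/eqP; lia.
Qed.

(** The sum of [k] coordinates of [x] is bounded by [psum k e] and, including [t], by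
    [psum k.+1 e - t]. For [k <= i] the first bound is the stricter, as [t <= e k]; for [i < k] the
    second is, as [e k <= t]. By [psum_ins] the stricter one is [psum k] of the merged sequence. *)
Lemma poly_ineq_consf n e i t x : decreasing n.+1 e -> (i <= n)%N ->
  low n e i <= t <= e i ->
  poly_ineq n.+1 e (consf t x) <-> poly_ineq n (ins i (e i + e i.+1 - t) e) x.
Proof.
move=> ed iln /andP[lt te].
have lt0 : 0 <= t by apply: le_trans lt; have /andP[] := decreasing_low ed iln.
(* For [i = n] the value [e n.+1] is arbitrary, but then [s] is entry [n] of the merged sequence,
   which [poly_ineq n] does not read. *)
set s := e i + e i.+1 - t.
have psE k : psum (k + (i < k))%N e = psum k (ins i s e) + (i < k)%:R * t.
  by rewrite (psum_ins i s) /s; congr (_ + _ * _); ring.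
have cons_sum (m : nat -> bool) : \sum_(j < n.+1 | m j) consf t x j =
    (if m 0%N then t else 0) + \sum_(j < n | m j.+1) x j.
  by rewrite big_mkcond big_ord_recl/=; congr (_ + _); rewrite -big_mkcond.
have cons_card (m : nat -> bool) : (\sum_(j < n.+1) m j = m 0 + \sum_(j < n) m j.+1)%N.
  by rewrite big_ord_recl.
have card_le (m : nat -> bool) : (\sum_(j < n) m j <= n)%N.
  rewrite -[leqRHS]card_ord -sum1_card; apply: leq_sum => j _; exact: leq_b1.
split=> -[x0 xm]; split.
- by move=> j jn; exact: (x0 j.+1).
- move=> m; set k := (\sum_(j < n) m j)%N.
  (* The first coordinate joins the set exactly when this gives the stricter bound. *)
  pose m' j := if j is j'.+1 then m j' else (i < k)%N.
  have := xm m'; rewrite (cons_sum m') (cons_card m') /= -/k addnC psE.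
  by case: (i < k)%N => /=; rewrite ?mul1r ?mul0r; lra.
- by case=> [//|j] jn; exact: x0.
- move=> m; rewrite cons_sum cons_card.
  have /= := xm (fun j => m j.+1); set k := (\sum_(j < n) m j.+1)%N.
  have kn : (k <= n)%N by exact: (card_le (fun j => m j.+1)).
  have psS j : psum j.+1 e = psum j e + e j by rewrite /psum big_ord_recr.
  have := psE k; case: ltnP => [ik|ki].
    rewrite mul1r addn1 psS; case: (m 0%N); rewrite ?add1n ?add0n ?add0r.
      by rewrite psS; lra.
    have ek : e k <= t.
      apply: le_trans lt; rewrite /low ifF; last by apply/eqP; lia.
      by apply: (decreasing_le ed); lia.
    lra.
  rewrite addn0 mul0r addr0; case: (m 0%N); last by rewrite add0n add0r => ->.
  rewrite add1n.
  have ek : t <= e k by apply: le_trans te _; apply: (decreasing_le ed); lia.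
  by rewrite psS; lra.
Qed.

Lemma poly_ineq_head n e x : poly_ineq n.+1 e x -> 0 <= x 0%N <= e 0%N.
Proof.
move=> [x0 xm]; rewrite x0//=.
have := xm (fun j => j == 0%N); rewrite (bigD1 ord0)//= big1; last first.
  by move=> [[|j] jn]//=.
rewrite addr0 big_ord_recl/= big1// addn0.
by rewrite /psum big_ord1.
Qed.

Lemma poly_ineq_local n e x y : (forall i, (i < n)%N -> x i = y i) ->
  poly_ineq n e x -> poly_ineq n e y.
Proof.
move=> xy [x0 xm]; split=> [i iN|m]; first by rewrite -xy// x0.
by apply: le_trans (xm m); rewrite le_eqVlt (eq_bigr (fun i : 'I_n => x i)) ?eqxx// => i _;
  rewrite xy.
Qed.

Lemma poly_ineq_convex n e x y l : 0 <= l <= 1 ->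
  poly_ineq n e x -> poly_ineq n e y ->
  poly_ineq n e (fun i => l * x i + (1 - l) * y i).
Proof.
move=> /andP[l0 l1] [x0 xm] [y0 ym]; have l1' : 0 <= 1 - l by rewrite subr_ge0.
split=> [i iN|m]; first by rewrite addr_ge0// mulr_ge0// ?x0 ?y0.
rewrite big_split/= -!mulr_sumr.
rewrite [leRHS](_ : _ = l * psum (\sum_(i < n) m i) e +
  (1 - l) * psum (\sum_(i < n) m i) e); last by ring.
by apply: lerD; apply: ler_wpM2l.
Qed.

(* [x_0, .., x_(n-1)] is a permutation of [e_0, .., e_(n-1)] with some entries
   replaced by 0. *)
Fixpoint vertex n e x : Prop :=
  if n is n'.+1 then
    exists2 j, (j <= n')%N & (x 0%N = 0 \/ x 0%N = e j) /\
      vertex n' (skip j e) (fun i => x i.+1)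
  else True.

Lemma vertex_local n e e' x : (forall k, (k < n)%N -> e k = e' k) ->
  vertex n e x -> vertex n e' x.
Proof.
elim: n e e' x => [//|n IH] e e' x ee' [j jn [xj xv]]; exists j => //.
rewrite -ee'//; split=> //; apply: IH xv => k kn.
by apply: ee'; rewrite /bump; lia.
Qed.

(* At most one coordinate of a vertex uses the entry [s], and that one equals [s]. *)
Lemma vertex_line n e i s x : vertex n (upd e i s) x ->
  exists u w : nat -> R, x = (fun k => u k + s * w k) /\
    forall s', vertex n (upd e i s') (fun k => u k + s' * w k).
Proof.
elim: n e i x => [|n IH] e i x.
  by move=> _; exists x, (fun=> 0); split=> //; apply/funext => k; rewrite mulr0 addr0.
move=> [j jn []]; case: (eqVneq j i) jn => [->|ji] jn.
  rewrite skip_upd /upd eqxx => -[x0|x0] xv.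
    exists x, (fun=> 0); split.
      by apply/funext => k; rewrite mulr0 addr0.
    move=> s'; exists i => //.
    rewrite skip_upd mulr0 addr0 x0; split; first by left.
    by move: xv; congr (vertex n _ _); apply/funext => k; rewrite /= ?mulr0 addr0.
  exists (consf 0 (fun k => x k.+1)), (consf 1 (fun=> 0)); split.
    by apply/funext => -[|k]/=; rewrite ?x0; ring.
  move=> s'; exists i => //.
  rewrite skip_upd/= mulr1 add0r /upd eqxx; split; first by right.
  by move: xv; congr (vertex n _ _); apply/funext => k; rewrite /= ?mulr0 addr0.
have iE : i = bump j (unbump j i) by rewrite unbumpK// inE eq_sym.
rewrite iE skip_upd_bump -iE => x0 /IH[u [w [xE uw]]].
exists (consf (x 0%N) u), (consf 0 w); split.
  by apply/funext => -[|k] /=; [ring|have /(congr1 (@^~ k)) := xE].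
move=> s'; exists j => //; split; last by rewrite iE skip_upd_bump; exact: uw.
by move: x0; rewrite /= mulr0 addr0 /upd (negbTE ji).
Qed.

Lemma between_convex a b t : a <= t <= b ->
  exists2 l, 0 <= l <= 1 & t = l * b + (1 - l) * a.
Proof.
move=> /andP[at_ tb]; case: (eqVneq a b) => [ab|ab].
  by exists 0; [rewrite lexx ler01|apply/eqP; rewrite eq_le; apply/andP; split; lra].
have ba : 0 < b - a by rewrite subr_gt0 lt_neqAle ab (le_trans at_ tb).
exists ((t - a) / (b - a)).
  apply/andP; split; first by apply: divr_ge0; [rewrite subr_ge0|exact: ltW].
  by rewrite ler_pdivrMr// mul1r lerB.
by field; rewrite gt_eqF.
Qed.

(** The hull is represented by an arbitrary predicate [K] closed under convex combinations, so that
    the induction can replace it by [K (consf t _)]. *)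
Lemma poly_ineq_sub_hull n e x (K : (nat -> R) -> Prop) :
  decreasing n e -> poly_ineq n e x ->
  (forall y z l, 0 <= l <= 1 -> K y -> K z ->
    K (fun i => l * y i + (1 - l) * z i)) ->
  (forall y, vertex n e y -> K y) -> K x.
Proof.
elim: n e x K => [|n IH] e x K ed xe Kconv Kvert; first exact: Kvert.
have [i iN tlow] := exists_low ed (poly_ineq_head xe).
move: xe; rewrite {1}(consfE x) => /(poly_ineq_consf _ ed iN tlow).
set t := x 0%N in tlow *; set s := e i + e i.+1 - t => xs.
rewrite (consfE x) -/t.
apply: (IH (ins i s e) _ (fun y => K (consf t y))) => //.
- apply: decreasing_ins => // ltin; move: tlow; rewrite /low ifF ?/s; last by apply/eqP; lia.
  by move=> /andP[h1 h2]; apply/andP; split; lra.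
- move=> y z l l01 Ky Kz.
  rewrite (_ : consf _ _ = (fun k => l * consf t y k + (1 - l) * consf t z k)).
    exact: Kconv.
  by apply/funext => -[|k]//=; ring.
move=> y; case: (eqVneq i n) tlow => [-> |iNn]; rewrite /low.
  rewrite eqxx => /between_convex[l l01 tE] yv.
  have {}yv : vertex n (skip n e) y.
    by apply: vertex_local yv => k kn; rewrite insE kn /skip /bump leqNgt kn.
  rewrite (_ : consf _ _ = (fun k => l * consf (e n) y k + (1 - l) * consf 0 y k)).
    by apply: Kconv => //; apply: Kvert; exists n => //; split=> //; [right|left].
  by apply/funext => -[|k]//=; ring.
(* The first coordinate and [s] add up to [e_i + e_(i+1)], so the point lies on
   a segment whose ends, where the two values are exchanged, are vertices. *)
rewrite (negbTE iNn) => /between_convex[l l01 tE] /vertex_line[u [w [-> uw]]].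
rewrite (_ : consf _ _ = (fun k =>
  l * consf (e i) (fun k => u k + e i.+1 * w k) k +
  (1 - l) * consf (e i.+1) (fun k => u k + e i * w k) k)).
  apply: Kconv => //; apply: Kvert.
    exists i => //; split; first by right.
    by have := uw (e i.+1); rewrite -/(ins _ _ _) ins_snd.
  exists i.+1; first by lia.
  split; first by right.
  by have := uw (e i); rewrite -/(ins _ _ _) ins_fst.
by apply/funext => -[|k]//=; rewrite /s tE; ring.
Qed.

Lemma vertex_value n e x i : vertex n e x -> (i < n)%N ->
  x i = 0 \/ exists2 j, (j < n)%N & x i = e j.
Proof.
elim: n e x i => [//|n IH] e x i [j jn [xj xv]].
case: i => [_|i iN].
  by case: xj => ->; [left|right; exists j].
have [->|[k kn ->]] := IH _ _ i xv iN; first by left.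
by right; exists (bump j k) => //; rewrite /bump; lia.
Qed.

(** Coordinates above [v >= 0] are nonzero, hence entries of [e] at distinct indices. *)
Lemma vertex_count n e x v : 0 <= v -> vertex n e x ->
  (\sum_(i < n) (v < x i)%R <= \sum_(i < n) (v < e i)%R)%N.
Proof.
move=> v0; elim: n e x => [|n IH] e x; first by rewrite !big_ord0.
move=> [j jn [xj xv]]; rewrite big_ord_recl.
have jn' : (j < n.+1)%N by [].
rewrite (bigD1_ord (Ordinal jn'))//=; apply: leq_add; last exact: IH xv.
by case: xj => ->//; rewrite ltNge v0.
Qed.

End Polymatroid.

(** Counted from 1, b_v <= v says that at most n - v entries exceed v; this form avoids sorting. *)
Lemma parking_functionP n (a : n.-tuple nat) :
  parking_function a <->
  (forall i, 0 < tnth a i <= n)%N /\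
  (forall v, (v <= n)%N -> (\sum_(i < n) (v < tnth a i) <= n - v)%N).
Proof.
have cnt v : (\sum_(i < n) (v < tnth a i) = count (fun x => v < x) (sort leq a))%N.
  rewrite (permP (permEl (perm_sort leq a))) -sum1_count big_tuple.
  by rewrite [RHS]big_mkcond; apply: eq_bigr => i _; case: ltnP.
have allP_ : all (fun x => 0 < x <= n)%N a <-> (forall i, 0 < tnth a i <= n)%N.
  split=> [/all_tnthP//|h]; exact/all_tnthP.
set b := sort leq a; have sb : size b = n by rewrite size_sort size_tuple.
have srt : sorted leq b by exact: (sort_sorted leq_total).
split.
- move=> /andP[/allP_ a1 /forallP h]; split=> // v vn.
  rewrite cnt -/b -(cat_take_drop v b) count_cat.
  rewrite (_ : count _ (take v b) = 0%N) ?add0n.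
    by rewrite (leq_trans (count_size _ _))// size_drop sb.
  apply/eqP; rewrite -leqn0 leqNgt -has_count; apply/hasPn => x /(nthP 0%N)[i].
  rewrite size_take_min sb leq_min => /andP[iv iN]; rewrite nth_take// => <-.
  by rewrite -leqNgt; exact: leq_trans (h (Ordinal iN)) iv.
- move=> [/allP_ a1 h]; apply/andP; split=> //; apply/forallP => i.
  rewrite leqNgt; apply/negP => ib.
  have := h i.+1 (ltn_ord i); rewrite cnt -/b -(cat_take_drop i b) count_cat.
  suff -> : count (fun x => i.+1 < x)%N (drop i b) = (n - i)%N.
    by have := ltn_ord i; lia.
  have <- : size (drop i b) = (n - i)%N by rewrite size_drop sb.
  apply/eqP; rewrite -all_count; apply/(all_nthP 0%N) => k.
  rewrite size_drop nth_drop => kb; apply: leq_trans ib _.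
  by apply: (sorted_leq_nth leq_trans leqnn 0%N srt); rewrite ?inE ?sb; have := ltn_ord i; lia.
Qed.

Lemma sum_lt_nat n m : (m <= n)%N -> (\sum_(i < n) (i < m) = m)%N.
Proof.
move=> mn; rewrite -(big_mkord xpredT (fun i => (i < m) : nat)%N).
rewrite (@big_cat_nat _ _ _ m)//= [X in (_ + X)%N]big_nat_cond.
rewrite [X in (_ + X)%N]big1 ?addn0; last by move=> i; case: ltnP => //; lia.
rewrite (@eq_big_nat _ _ _ _ _ _ (fun=> 1%N)); last by move=> i /andP[_ ->].
by rewrite sum_nat_const_nat muln1 subn0.
Qed.

(** * The parking polytope as the polymatroid of the staircase *)

Section ParkingPolytope.
Context {R : realType}.

Lemma psum_staircase n k : (k <= n)%N ->
  psum k (staircase n) = (\sum_(j < k) (n - 1 - j))%:R :> R.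
Proof.
move=> kn; rewrite /psum natr_sum; apply: eq_bigr => j _; rewrite /staircase.
by have := ltn_ord j => jk; rewrite !natrB//; lia.
Qed.

(** Both sides are summed by layers [v]: at most min(k, n - 1 - v) of the [k] chosen coordinates
    exceed [v], and exactly that many of the first [k] entries of the staircase do. *)
Lemma parking_poly_ineq n (a : n.-tuple nat) (x : nat -> R) :
  parking_function a -> (forall i : 'I_n, x i + 1 = (tnth a i)%:R) ->
  poly_ineq n (staircase n) x.
Proof.
move=> /parking_functionP[a1 acount] xa.
have xE (i : 'I_n) : x i = (tnth a i).-1%:R.
  by apply: (addIr 1); rewrite xa natr1; have := a1 i; case: (tnth a i).
split=> [i iN|m]; first by rewrite (xE (Ordinal iN)).
set k := (\sum_(i < n) m i)%N.
have kn : (k <= n)%N.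
  by rewrite -[leqRHS]card_ord -sum1_card; apply: leq_sum => j _; exact: leq_b1.
rewrite psum_staircase// (eq_bigr _ (fun i _ => xE i)) -natr_sum ler_nat.
have -> : (\sum_(i < n | m i) (tnth a i).-1 =
    \sum_(v < n) \sum_(i < n | m i) (v < (tnth a i).-1))%N.
  rewrite exchange_big/=; apply: eq_bigr => i _; rewrite sum_lt_nat//.
  by have := a1 i; lia.
have -> : (\sum_(j < k) (n - 1 - j) = \sum_(v < n) \sum_(j < k) (j < n - 1 - v))%N.
  rewrite exchange_big/=; apply: eq_bigr => j _; rewrite -[LHS](@sum_lt_nat n); last by lia.
  by apply: eq_bigr => v _; congr nat_of_bool; lia.
apply: leq_sum => v _.
have le1 : (\sum_(i < n | m i) (v < (tnth a i).-1) <= n - 1 - v)%N.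
  have := acount v.+1 (ltn_ord v); rewrite subnS -subn1 subnAC; apply: leq_trans.
  rewrite big_mkcond; apply: leq_sum => i _; case: (m i) => //.
  by have := a1 i; lia.
have le2 : (\sum_(i < n | m i) (v < (tnth a i).-1) <= k)%N.
  by rewrite /k big_mkcond; apply: leq_sum => i _; case: (m i); rewrite ?leq_b1.
case: (leqP k (n - 1 - v)) => kv; last first.
  by rewrite [leqRHS]sum_lt_nat// ltnW.
rewrite [leqRHS](eq_bigr (fun=> 1%N)) => [|j _].
  by rewrite [leqRHS]sum1_card card_ord.
by have := ltn_ord j; lia.
Qed.

Lemma vertex_parking n (z : nat -> R) : vertex n (staircase n) z ->
  parking_points (\row_(i < n) (z i + 1)).
Proof.
move=> zv.
have zc (i : 'I_n) : exists c, (c < n)%N /\ z i = c%:R.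
  have [->|[j jn ->]] := vertex_value zv (ltn_ord i).
    by exists 0%N; split=> //; exact: leq_ltn_trans (leq0n i) (ltn_ord i).
  by exists (n - 1 - j)%N; split; [lia|rewrite /staircase !natrB//; lia].
have [c cz] := fin_all_exists zc.
exists [tuple (c i).+1 | i < n]; last first.
  by apply/rowP => i; rewrite !mxE tnth_mktuple (cz i).2 natr1.
apply/parking_functionP; split=> [i|v vn].
  by rewrite tnth_mktuple; have := (cz i).1; lia.
case: v vn => [_|v vn].
  rewrite subn0 -[leqRHS]card_ord -sum1_card; apply: leq_sum => j _; exact: leq_b1.
have := vertex_count (ler0n R v) zv.
rewrite [X in (_ <= X)%N -> _](_ : _ = n - v.+1)%N.
  apply: leq_trans; apply: leq_sum => i _.
  by rewrite tnth_mktuple (cz i).2 ltr_nat.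
rewrite -[RHS](@sum_lt_nat n); last by lia.
apply: eq_bigr => i _; congr nat_of_bool; rewrite /staircase.
have -> : n%:R - 1 - i%:R = (n - 1 - i)%:R :> R by rewrite !natrB//; have := ltn_ord i; lia.
by rewrite ltr_nat; lia.
Qed.

Lemma decreasing_staircase n : decreasing n (@staircase R n).
Proof.
split=> i iN; rewrite /staircase; first by rewrite -natr1; lra.
by rewrite -addrA -opprD subr_ge0 nat1r ler_nat.
Qed.

(** The polymatroid is convex and contains the parking points, which gives one inclusion; its
    vertices are parking points, which gives the other. *)
Lemma parking_polytopeE n (x : nat -> R) :
  parking_polytope (\row_(i < n) (x i + 1)) <-> poly_ineq n (staircase n) x.
Proof.
split=> [h|xe].
- pose S : set 'rV[R]_n := [set v | exists2 x : nat -> R,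
    v = \row_(i < n) (x i + 1) & poly_ineq n (staircase n) x].
  have [||y xy] := @smallest_sub _ (@convex_set R 'rV[R]_n) (parking_points (R:=R) (n:=n)) S _ _ _ h.
  + move=> u v l; rewrite !inE => -[y -> ye] [z -> ze].
    exists (fun i => l%:num * y i + (1 - l%:num) * z i); last first.
      by apply: poly_ineq_convex => //; rewrite ge0 le1.
    by apply/rowP => i; rewrite !mxE /unstable.onem; ring.
  + move=> _ [a pa ->]; pose y i : R := (nth 1%N a i)%:R - 1.
    have yE (i : 'I_n) : y i + 1 = (tnth a i)%:R by rewrite /y subrK (tnth_nth 1%N).
    exists y; last exact: parking_poly_ineq pa yE.
    by apply/rowP => i; rewrite !mxE yE.
  + apply: poly_ineq_local => i iN.
    by have /rowP/(_ (Ordinal iN)) := xy; rewrite !mxE => /addIr ->.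
- apply: (poly_ineq_sub_hull (K := fun x => parking_polytope (\row_(i < n) (x i + 1)))
    (@decreasing_staircase n) xe).
  + move=> y z l /andP[l0 l1] Ky Kz X [cX pX].
    have Xy := Ky X (conj cX pX); have Xz := Kz X (conj cX pX).
    have := cX _ _ (Itv01 l0 l1) (mem_set Xy) (mem_set Xz); rewrite inE.
    congr X; apply/rowP => i; rewrite !mxE /unstable.onem/=; ring.
  + by move=> z /vertex_parking zp; exact: sub_gen_smallest.
Qed.

End ParkingPolytope.

(** * Volumes *)

Section Volume.
Context {R : realType}.
Local Notation mu := (@lebesgue_measure R).

Lemma integral_horner (p : {poly R}) a b : a <= b ->
  (\int[mu]_(x in `[a, b]) (p.[x])%:E = (pint (horner p) a b)%:E)%E.
Proof.
rewrite le_eqVlt => /predU1P[->|ab].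
  by rewrite set_itv1 integral_set1 pint_horner subrr.
have dprim x : (horner (prim p))^`()%classic x = p.[x] by rewrite -derivE deriv_prim.
rewrite (@continuous_FTC2 _ _ (horner (prim p)))// ?pint_horner//.
- by apply: continuous_subspaceT => x; exact: continuous_horner.
- split=> [x _| |].
  + exact: derivable_horner.
  + by apply: cvg_at_right_filter; exact: continuous_horner.
  + by apply: cvg_at_left_filter; exact: continuous_horner.
Qed.

Lemma pint_reflect (p : {poly R}) A a b :
  pint (horner (p \Po (A%:P - 'X))) a b = pint (horner p) (A - b) (A - a).
Proof.
have -> : horner (p \Po (A%:P - 'X)) = horner (- (prim p \Po (A%:P - 'X)))^`().
  apply/funext => s; rewrite derivN deriv_comp deriv_prim derivB derivC derivX.
  by rewrite sub0r mulrN1 opprK.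
rewrite pintE pint_horner !hornerN !horner_comp !hornerD !hornerN !hornerC !hornerX.
by ring.
Qed.

Lemma measurable_horner_on (p : {poly R}) (D : set R) (g : R -> \bar R) :
  (forall x, D x -> g x = (p.[x])%:E) -> measurable_fun D g.
Proof.
move=> gp; apply: (eq_measurable_fun (EFin \o horner p)).
  by move=> x /set_mem xD; rewrite gp.
apply/measurable_EFinP/measurable_funTS; apply: continuous_measurable_fun.
exact: continuous_horner.
Qed.

(** Measurability is established along with the integral, since additivity over the pieces requires
    it and [g] is described only piecewise. *)
Lemma integral_piecewise_horner (g : R -> \bar R) (b : nat -> R)
    (p : nat -> {poly R}) n : (forall x, 0 <= g x)%E ->
  (forall i, (i < n)%N -> b i.+1 <= b i) ->
  (forall i x, (i < n)%N -> b i.+1 <= x <= b i -> g x = ((p i).[x])%:E) ->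
  measurable_fun `[b n, b 0%N] g /\
  (\int[mu]_(x in `[b n, b 0%N]) g x =
   (\sum_(i < n) pint (horner (p i)) (b i.+1) (b i))%:E)%E.
Proof.
move=> g0; elim: n => [|n IH] bd gp.
  by rewrite big_ord0 set_itv1 integral_set1; split=> //; exact: measurable_fun_set1.
have [mg ig] := IH (fun i iN => bd i (ltnW iN)) (fun i x iN => gp i x (ltnW iN)).
have bn : b n <= b 0%N.
  elim: n bd {IH gp mg ig} => [//|n IH] bd.
  apply: le_trans (IH _); first by apply: bd; lia.
  by move=> i iN; apply: bd; lia.
have b1 : b n.+1 <= b n by exact: bd.
have gpn x : `[b n.+1, b n]%classic x -> g x = ((p n).[x])%:E.
  by rewrite /= in_itv/= => xb; apply: gp.
have gpn' x : `[b n.+1, b n[%classic x -> g x = ((p n).[x])%:E.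
  by rewrite /= in_itv/= => /andP[xb /ltW xb']; apply: gp => //; rewrite xb.
have mg1 : measurable_fun `[b n.+1, b n[ g := measurable_horner_on gpn'.
have UE : `[b n.+1, b n[ `|` `[b n, b 0%N] = `[b n.+1, b 0%N]%classic.
  apply/seteqP; split => x /=; rewrite !in_itv/=.
    by move=> [] /andP[h1 h2]; apply/andP; split; lra.
  move=> /andP[h1 h2]; case: (ltP x (b n)) => h3; [left|right]; lra.
have mU : measurable_fun (`[b n.+1, b n[ `|` `[b n, b 0%N]) g.
  by apply/measurable_funU => //; split.
split; first by rewrite -UE.
rewrite -UE ge0_integral_setU//; last first.
  rewrite disj_set2E; apply/eqP/seteqP; split=> // x [] /=; rewrite !in_itv/=.
  by move=> /andP[_ h1] /andP[h2 _]; move: h2; rewrite leNgt h1.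
rewrite integral_itv_bndo_bndc// ig big_ord_recr/= EFinD addeC; congr (_ + _)%E.
rewrite -integral_horner//; apply: eq_integral => x /set_mem.
exact: gpn.
Qed.

Lemma lebesgue_poly_ineq n (e : nat -> R) c : decreasing n e ->
  lebesgue_tuple R n [set t | poly_ineq n e (fun i => nth 0 t i - c)] = (W n e)%:E.
Proof.
elim: n e => [|n IH] e ed.
  rewrite /= diracE mem_set//=; split=> // m.
  by rewrite !big_ord0 /psum big_ord0.
pose g x : \bar R := lebesgue_tuple R n
  [set t | poly_ineq n.+1 e (consf (x - c) (fun i => nth 0 t i - c))].
transitivity (\int[mu]_x g x)%E.
  rewrite /= /cons_measure /pushforward /product_measure1.
  apply: eq_integral => x _ /=; rewrite /g; congr (lebesgue_tuple R n _).
  apply/seteqP; split=> t; rewrite /xsection/= ?inE/= => tS;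
    move: tS; congr (poly_ineq n.+1 e _); by apply/funext => -[].
have pP i : exists p : {poly R}, (fun s => W n (ins i s e)) = horner p.
  exact: polyfun_line (polyfun_W n).
have [p pE] := choice pP.
(* In the section at [x], the first coordinate is t = x - c and the merged entry is e_i + e_(i+1) -
   t, so the volume is the reflected polynomial. *)
pose q i : {poly R} := p i \Po ((e i + e i.+1 + c)%:P - 'X).
have qE i x : (q i).[x] = W n (ins i (e i + e i.+1 - (x - c)) e).
  rewrite /q horner_comp !hornerE -[LHS](congr1 (@^~ _) (pE i)) /=.
  by congr (W n (ins i _ e)); ring.
(* The breakpoints of the section volume, in decreasing order; the last one, at [n.+1], comes from
   the constraint that coordinates are nonnegative. *)
pose b i := (if i == n.+1 then 0 else e i) + c.
have bS i : (i < n.+1)%N -> b i.+1 = low n e i + c.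
  by rewrite /b /low eqSS.
have b_lt i : (i < n.+1)%N -> b i = e i + c.
  by rewrite /b; case: eqP => // ->; rewrite ltnn.
have g0 x : (0 <= g x)%E by exact: measure_ge0.
have gq i x : (i < n.+1)%N -> b i.+1 <= x <= b i -> g x = ((q i).[x])%:E.
  move=> iN; rewrite bS// b_lt// => xi.
  have {}xi : low n e i <= x - c <= e i by move/andP : xi => [h1 h2]; apply/andP; split; lra.
  rewrite qE -IH; last first.
    apply: decreasing_ins => // ltin; move: xi; rewrite /low ifF; last by apply/eqP; lia.
    by move=> /andP[h1 h2]; apply/andP; split; lra.
  congr (lebesgue_tuple R n _); apply/seteqP; split=> t /=;
    have H := poly_ineq_consf (fun i => nth 0 t i - c) ed iN xi.
    by move/H.
  by move=> tS; apply/H.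
have bd i : (i < n.+1)%N -> b i.+1 <= b i.
  by move=> iN; rewrite bS// b_lt// lerD2r; have /andP[] := decreasing_low ed iN.
have [_] := integral_piecewise_horner g0 bd gq.
rewrite integral_mkcond => gint.
transitivity (\int[mu]_x (g \_ `[b n.+1, b 0%N]) x)%E.
  congr (integral _ _ _); apply/funext => x; rewrite patchE; case: ifPn => // /negP xb.
  rewrite /g [X in lebesgue_tuple R n X](_ : _ = set0) ?measure0//.
  apply/seteqP; split=> // t /= /poly_ineq_head/= /andP[h1 h2].
  by apply: xb; rewrite inE/= in_itv/= /b eqxx/=; apply/andP; split; lra.
have -> : W n.+1 e = \sum_(i < n) slice_int i (W n) e + e n * W n e by rewrite WS addrC.
rewrite gint big_ord_recr/=; congr ((_ + _)%:E).
  apply: eq_bigr => i _; have iN := ltn_ord i.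
  rewrite /slice_int pE pint_reflect b_lt; last by lia.
  rewrite {1}/b ifF; last by apply/eqP; lia.
  by congr (pint _ _ _); ring.
(* On the last piece the merged entry has index [n], which [W n] does not read: the integrand is
   constant and the integral is [e n * W n e]. *)
have -> : horner (q n) = horner (W n e *: 'X)^`().
  apply/funext => x; rewrite qE derivZ derivX hornerZ hornerC mulr1.
  by apply: W_local => k kn; rewrite insE kn.
rewrite pintE !hornerZ !hornerX b_lt// /b eqxx; ring.
Qed.

Lemma V_staircase n : V R n = (W n (staircase n))%:E.
Proof.
have vol k : volume (parking_polytope (R := R) (n := k)) = (W k (staircase k))%:E.
  rewrite -(@lebesgue_poly_ineq _ _ 1 (@decreasing_staircase R k)) /volume.
  congr (lebesgue_tuple R k _); apply/funext => t; apply/propext.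
  have := parking_polytopeE k (fun i => nth 0 (t : k.-tuple R) i - 1).
  rewrite (_ : \row_(i < k) _ = \row_(i < k) tnth t i)//.
  by apply/rowP => i; rewrite !mxE subrK (tnth_nth 0).
by case: n => [//|n]; exact: vol.
Qed.

End Volume.

Theorem theorem4p1 (R : realType) (n : nat) (hn : (2 <= n)%N) :
  V R n =
  ((n%:R^-1)%:E *
   \sum_(0 <= k < n)
     ('C(n, k)%:R * ((n - k)%:R ^+ (n - k - 1) * (n%:R + k%:R - 1) / 2))%:E
       * V R k)%E.
Proof.
rewrite V_staircase; under eq_bigr => k _ do rewrite V_staircase -EFinM subn1.
have n0 : n%:R != 0 :> R by rewrite pnatr_eq0; lia.
by rewrite sumEFin -EFinM -W_staircase mulKf.
Qed.
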